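(* Fix integers $d\ge 4$ and $x$ such that $2x\le 3d+1$. Then $\mathbb{T}(3,d;x)'=\emptyset$.
   Context: We work over an algebraically closed field of characteristic $0$. For a finite set $S\subset\mathbb{P}^n$, $\langle S\rangle$ is its linear span, and $2S\subset\mathbb{P}^n$ is the zero-dimensional scheme defined by the ideal sheaf $(\mathcal{I}_S)^2$ (the union of the double points supported at $S$). For a closed subscheme $Z\subset\mathbb{P}^n$, $h^i(\mathcal{I}_Z(d))=\dim H^i(\mathbb{P}^n,\mathcal{I}_Z(d))$. $\mathbb{T}(n,d;x)$ is the set of all subsets $S\subset\mathbb{P}^n$ of cardinality $x$ such that $h^0(\mathcal{I}_{2S}(d))>0$, $h^1(\mathcal{I}_{2S}(d))>0$ and $\langle S\rangle=\mathbb{P}^n$. $\mathbb{T}(n,d;x)'$ (the minimally Terracini sets) is the set of all $S\in\mathbb{T}(n,d;x)$ such that $h^1(\mathcal{I}_{2A}(d))=0$ for all $A\subsetneq S$. *)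

(* Defs.v *)
From HB Require Import structures.
From mathcomp Require Import all_boot all_order all_algebra.
From mathcomp Require Import finmap.
From mathcomp Require Import mpoly.

Set Implicit Arguments.
Unset Strict Implicit.
Unset Printing Implicit Defensive.

Import GRing.Theory.

Local Open Scope ring_scope.

(* P^n as the set of lines through the origin of k^(n+1). *)
Definition projspace (k : fieldType) (n : nat) : Type :=
  {L : {vspace 'rV[k]_n.+1} | \dim L == 1%N}.

HB.instance Definition _ (k : fieldType) (n : nat) :=
  Choice.on (projspace k n).

Section Cohomology.

Variables (k : fieldType) (n : nat).

(* <S> is all of P^n. *)
Definition spanning (S : {fset projspace k n}) : Prop :=
  (\sum_(p <- S) val p)%VS = fullv.

(* The homogeneous ideal I(S): S is a set of full lines, so these are the
   polynomials vanishing on the affine cone over S. *)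
Definition van_ideal (S : {fset projspace k n}) (F : {mpoly k[n.+1]}) : Prop :=
  forall p, p \in S -> forall v, v \in val p -> F.@[fun i => v 0 i] = 0.

Definition ideal_square (I : {mpoly k[n.+1]} -> Prop) (F : {mpoly k[n.+1]}) :
    Prop :=
  exists (r : nat) (G H : 'I_r -> {mpoly k[n.+1]}),
    (forall j, I (G j) /\ I (H j)) /\ F = \sum_j G j * H j.

(* The graded module I(S)^2, whose associated sheaf is (I_S)^2, that is, the
   ideal sheaf of the scheme 2S. *)
Definition double_points (S : {fset projspace k n}) :
    {mpoly k[n.+1]} -> Prop :=
  ideal_square (van_ideal S).

Let K := {fraction {mpoly k[n.+1]}}.

(* Below J is a homogeneous ideal and J~ the associated sheaf on P^n.  Its
   cohomology is that of the Cech complex of the standard affine cover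
   U_i = {X_i <> 0}.  The open set indexed by a nonempty s is the intersection
   U_s of the U_i with i in s; the sections of J~(d) over it form the degree d
   part of the localization of J at X_s = \prod_(i in s) X_i.  All of these
   live in k(X_0, ..., X_n), where the restriction maps are inclusions. *)
Definition section_over (J : {mpoly k[n.+1]} -> Prop) (d : nat)
    (s : {set 'I_n.+1}) (f : K) : Prop :=
  exists (m : nat) (F : {mpoly k[n.+1]}),
    [/\ J F, F \is (d + m * #|s|)%N.-homog &
        f = FracField.tofrac F /
            FracField.tofrac ((\prod_(i in s) 'X_i) ^+ m)].

Definition H0 (J : {mpoly k[n.+1]} -> Prop) (d : nat) (f : K) : Prop :=
  forall i : 'I_n.+1, section_over J d [set i] f.

Definition cocycle1 (J : {mpoly k[n.+1]} -> Prop) (d : nat)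
    (c : 'I_n.+1 -> 'I_n.+1 -> K) : Prop :=
  (forall i j, section_over J d [set i; j] (c i j)) /\
  (forall i j l, c j l - c i l + c i j = 0).

Definition coboundary1 (J : {mpoly k[n.+1]} -> Prop) (d : nat)
    (c : 'I_n.+1 -> 'I_n.+1 -> K) : Prop :=
  exists b : 'I_n.+1 -> K,
    (forall i, section_over J d [set i] (b i)) /\
    (forall i j, c i j = b j - b i).

(* h^i > 0 and h^i = 0 say that the vector space H^i is nonzero, resp. zero. *)
Definition h0_gt0 (J : {mpoly k[n.+1]} -> Prop) (d : nat) : Prop :=
  exists f, H0 J d f /\ f <> 0.

Definition h1_gt0 (J : {mpoly k[n.+1]} -> Prop) (d : nat) : Prop :=
  exists c, cocycle1 J d c /\ ~ coboundary1 J d c.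

Definition h1_eq0 (J : {mpoly k[n.+1]} -> Prop) (d : nat) : Prop :=
  forall c, cocycle1 J d c -> coboundary1 J d c.

Definition Terracini (d x : nat) (S : {fset projspace k n}) : Prop :=
  [/\ #|` S| = x, h0_gt0 (double_points S) d, h1_gt0 (double_points S) d &
      spanning S].

Definition min_Terracini (d x : nat) (S : {fset projspace k n}) : Prop :=
  Terracini d x S /\
  forall A : {fset projspace k n},
    (A `<` S)%fset -> h1_eq0 (double_points A) d.

End Cohomology.

(* Main.v *)
Require Import Defs.
From HB Require Import structures.
From mathcomp Require Import all_boot all_order all_algebra finmap mpoly.
From mathcomp Require Import zify ring.

(** A vector v_p is chosen on each line p of S.  The double points 2S fail to
    impose independent conditions on forms of degree d when some nontrivial
    combination of functionals F |-> a F(v_p) + D_w F(v_p), p in S, kills all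
    forms of degree d.  Such a relation lives on a scheme Z inside 2S whose
    length at each point is at most 2, so Z has length at most
    2x <= 3d + 1, and everything rests on how relations behave when a form is
    multiplied by a linear form l: a relation on Z in degree d + 1 becomes one
    in degree d on the residual scheme of Z with respect to the hyperplane
    l = 0.  Induction on the degree shows that a relation in degree d
    - vanishes if its length is at most d + 1 ([kills_short]),
    - lies on a line if its length is at most 2d + 1 ([kills_collinear]),
    - meets some plane in length at least d + 2 if it is nonzero of length at
      most 3d + 1 ([kills_plane]).

    Suppose now that S is minimal.  A relation involves every point of S, and
    no line contains more than (d + 1)/2 points of S, because 2a functionals
    along a line with 2a > d + 1 are dependent on binary forms of degree d
    ([line_relation]).  A plane meeting Z in length at least d + 2 leaves a
    residual relation of length at most 2d - 1 in degree d - 1.  It is not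
    zero, as S spans the space, so it lies on a line L and has length at least
    d + 1; hence L carries exactly (d + 1)/2 points of S, at each of which Z is
    double and tangent to L.  A plane through L and one more point leaves in
    the same way a second line R with no common point of S.  Multiplying by a
    form vanishing on L and one vanishing on R leaves length at most d - 1 in
    degree d - 2, hence nothing: S lies on L and R, which are skew because S
    spans.  Finally the square of a linear form vanishing on R and at one
    point of L also leaves length at most d - 1 in degree d - 2, but does not
    kill the other points of L: a contradiction ([no_spanning_relation]).

    The link with cohomology runs in two directions.  If there is no relation
    on 2S, first-order jets at S can be prescribed by forms of degree d
    ([jets_onto]).  A Cech cocycle of the ideal sheaf is a coboundary in
    O(d), by [cech_H1]; the local sections obtained have common jets at the
    points of S, and subtracting a form with these jets puts them in the ideal
    ([jets_h1_eq0]).  Conversely, if first cohomology vanishes then a jet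
    supported at one point is the jet of a global form, which no relation
    nonzero at that point can kill ([relation_h1]).  Both directions use that
    a form singular at each point of S lies, up to a power of any variable, in
    the square of the ideal of S ([saturation]); this holds because the ideals
    of distinct points are comaximal away from a coordinate hyperplane. *)

Set Implicit Arguments.
Unset Strict Implicit.
Unset Printing Implicit Defensive.

Import GRing.Theory.

Local Open Scope ring_scope.

(** * Linear relations between first-order functionals *)

Section FirstOrderFunctionals.

Variables (k : fieldType) (n : nat) (I : finType) (v : I -> 'rV[k]_n).

(** Linear forms are columns, so that the forms vanishing on the row space of B
    are the solutions of [B *m l = 0]. *)
Definition lval (l : 'cV[k]_n) (u : 'rV[k]_n) : k := (u *m l) 0 0.

(** A pair (a, w) at the point i stands for F |-> a F(v_i) + D_w F(v_i).  In
    this part polynomials never occur: multiplication by linear forms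
    determines everything. *)
Definition functional := I -> k * 'rV[k]_n.

Implicit Types (z : functional) (l : 'cV[k]_n) (d : nat).

(** By the product rule, the functional G |-> z(l G). *)
Definition residual l z : functional := fun i =>
  ((z i).1 * lval l (v i) + lval l (z i).2, lval l (v i) *: (z i).2).

(** Forms of degree d are spanned by products of d linear forms, and on the
    constant 1 only the values a are seen. *)
Fixpoint kills d z : Prop :=
  if d is d'.+1 then forall l, kills d' (residual l z)
  else \sum_i (z i).1 = 0.

(** For a tangent family this is the length at the point of the smallest scheme
    through which the functional factors: empty, reduced, or a tangent
    vector. *)
Definition wt (x : k * 'rV[k]_n) : nat :=
  if x.2 != 0 then 2%N else (x.1 != 0 : nat).

Definition len z : nat := \sum_i wt (z i).

(** By Euler's formula a derivative along v_i is a multiple of the value at v_i;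
    excluding it makes the pair (a, w) meaningful in every degree. *)
Definition tangent z := forall i, (z i).2 != 0 -> ~~ ((z i).2 <= v i)%MS.

Definition within m (B : 'M[k]_(m, n)) z : bool :=
  [forall i, (wt (z i) != 0)%N ==> (v i <= B)%MS && ((z i).2 <= B)%MS].

(** The length at one point of the intersection with the linear space B: a
    tangent vector based on B but not tangent to B meets it in a reduced
    point. *)
Definition wt_in m (B : 'M[k]_(m, n)) z i : nat :=
  if (v i <= B)%MS then
    (if ((z i).2 <= B)%MS then wt (z i) else 1%N) else 0%N.

Definition len_in m (B : 'M[k]_(m, n)) z : nat := \sum_i wt_in B z i.

Lemma lval0 l : lval l 0 = 0.
Proof. by rewrite /lval mul0mx mxE. Qed.

Lemma lvalZ l c u : lval l (c *: u) = c * lval l u.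
Proof. by rewrite /lval -scalemxAl mxE. Qed.

Lemma lvalD l u u' : lval l (u + u') = lval l u + lval l u'.
Proof. by rewrite /lval mulmxDl mxE. Qed.

Lemma lval_sub m (B : 'M[k]_(m, n)) l u :
  B *m l = 0 -> (u <= B)%MS -> lval l u = 0.
Proof. by move=> Bl /submxP[D ->]; rewrite /lval -mulmxA Bl mulmx0 mxE. Qed.

Lemma separate m (B : 'M[k]_(m, n)) u :
  ~~ (u <= B)%MS -> exists l, B *m l = 0 /\ lval l u != 0.
Proof.
rewrite submxE => /rowV0Pn [w]; case/submxP => D -> nz.
have : exists j, (u *m cokermx B) 0 j != 0.
  apply/existsP; apply: contraR nz => /existsPn h; apply/eqP.
  have -> : u *m cokermx B = 0.
    by apply/rowP=> j; rewrite [RHS]mxE; apply/eqP; move: (h j); rewrite negbK.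
  by rewrite mulmx0.
case=> j nzj; exists (col j (cokermx B)); split.
  by rewrite colE mulmxA mulmx_coker mul0mx.
by rewrite /lval colE mulmxA -colE mxE.
Qed.

Lemma sub_coll (u : 'rV[k]_n) m (B : 'M[k]_(m, n)) : (u <= col_mx u B)%MS.
Proof. by rewrite -addsmxE addsmxSl. Qed.

Lemma sub_colr (u : 'rV[k]_n) m (B : 'M[k]_(m, n)) : (B <= col_mx u B)%MS.
Proof. by rewrite -addsmxE addsmxSr. Qed.

Lemma wt_eq0 x : (wt x == 0)%N = (x == 0).
Proof.
case: x => a w; rewrite /wt xpair_eqE /= andbC.
by case: (w == 0); case: (a == 0).
Qed.

Lemma wt_le2 x : (wt x <= 2)%N.
Proof. by rewrite /wt; case: ifP => // _; case: (_ != _). Qed.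

Lemma wt_residual l z i : lval l (v i) != 0 -> wt (residual l z i) = wt (z i).
Proof.
move=> nz; rewrite /wt /residual /= scaler_eq0 (negbTE nz) /=.
case: eqP => //= ->; rewrite lval0 addr0 mulf_eq0 (negbTE nz) orbF //.
Qed.

Lemma residual0 l z i : z i = 0 -> residual l z i = 0.
Proof. by rewrite /residual => -> /=; rewrite mul0r scaler0 lval0 addr0. Qed.

Lemma residual_van l z i : lval l (v i) = 0 -> lval l (z i).2 = 0 ->
  residual l z i = 0.
Proof. by rewrite /residual => -> ->; rewrite mulr0 addr0 scale0r. Qed.

Lemma wt_residual_le l z i : (wt (residual l z i) <= wt (z i))%N.
Proof.
have [h|/wt_residual-> //] := eqVneq (lval l (v i)) 0.
rewrite /wt /residual /= h scale0r eqxx mulr0 add0r /=.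
have [->|_] := eqVneq (z i).2 0; first by rewrite lval0 eqxx.
by case: (_ != _).
Qed.

Lemma tangent_residual l z : tangent z -> tangent (residual l z).
Proof.
move=> tz i; rewrite /residual /= scaler_eq0 negb_or => /andP[nz /tz].
by rewrite (eqmx_scale _ nz).
Qed.

Lemma len_eq0P z : reflect (forall i, z i = 0) (len z == 0)%N.
Proof.
rewrite /len sum_nat_eq0; apply: (iffP forallP) => h i.
  by apply/eqP; rewrite -wt_eq0; apply: implyP (h i) _.
by rewrite h /= wt_eq0 eqxx.
Qed.

Lemma withinP m (B : 'M[k]_(m, n)) z :
  reflect (forall i, z i != 0 -> (v i <= B)%MS /\ ((z i).2 <= B)%MS)
          (within B z).
Proof.
apply: (iffP forallP) => h i.
  by rewrite -wt_eq0 => /(implyP (h i))/andP.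
by apply/implyP; rewrite wt_eq0 => /h/andP.
Qed.

Lemma residual_within m (B : 'M[k]_(m, n)) l z i :
  B *m l = 0 -> (v i <= B)%MS -> ((z i).2 <= B)%MS -> residual l z i = 0.
Proof. by move=> Bl vB wB; apply: residual_van; apply: lval_sub Bl _. Qed.

Lemma not_within_residual m (B : 'M[k]_(m, n)) z :
  ~~ within B z -> exists l, B *m l = 0 /\ (len (residual l z) != 0)%N.
Proof.
case/forallPn => i; rewrite negb_imply wt_eq0 negb_and => /andP[nz].
have [vB /= wB|vB _] := boolP (v i <= B)%MS.
  have [l [Bl lw]] := separate wB; exists l; split=> //.
  apply/len_eq0P => /(_ i)/(congr1 fst)/= /eqP.
  by rewrite (lval_sub Bl vB) mulr0 add0r (negbTE lw).
have [l [Bl lv]] := separate vB; exists l; split=> //.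
apply/len_eq0P => /(_ i)/eqP; rewrite -wt_eq0 wt_residual // wt_eq0.
by rewrite (negbTE nz).
Qed.

(** Passing to the residual with respect to a hyperplane containing B loses at
    least the part of the scheme which lies in B. *)
Lemma len_in_residual m (B : 'M[k]_(m, n)) l z :
  B *m l = 0 -> (len (residual l z) + len_in B z <= len z)%N.
Proof.
move=> Bl; rewrite /len /len_in -big_split /=; apply: leq_sum => i _.
rewrite /wt_in.
case: ifP => [vB|_]; last by rewrite addn0 wt_residual_le.
case: ifP => [wB|/negbT wB].
  by rewrite (residual_within Bl vB wB) /wt /= eqxx /= eqxx.
rewrite /wt /residual /= (lval_sub Bl vB) scale0r eqxx.
have -> : (z i).2 != 0 by apply: contraNneq wB => ->; rewrite sub0mx.
by case: (_ != _).
Qed.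

Lemma len_in_within m (B : 'M[k]_(m, n)) z : within B z -> len_in B z = len z.
Proof.
move/withinP => h; apply: eq_bigr => i _; rewrite /wt_in.
have [zi|/h[-> ->] //] := eqVneq (z i) 0.
by rewrite zi sub0mx /wt /= eqxx /= eqxx; case: ifP.
Qed.

Lemma len_in_residual_le m (B : 'M[k]_(m, n)) l z :
  (len_in B (residual l z) <= len_in B z)%N.
Proof.
apply: leq_sum => i _; rewrite /wt_in; case: ifP => // _.
have [lv|lv] := eqVneq (lval l (v i)) 0; last first.
  by rewrite wt_residual //= (eqmx_scale _ lv).
rewrite /= lv scale0r sub0mx; case: ifP => [_|_]; first exact: wt_residual_le.
by rewrite /wt /= lv scale0r eqxx; case: (_ != _).
Qed.

Lemma wt_in_subset m m' (B : 'M[k]_(m, n)) (B' : 'M[k]_(m', n)) z i :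
  (B <= B')%MS -> (wt_in B z i <= wt_in B' z i)%N.
Proof.
move=> BB'; rewrite /wt_in; case: ifP => // vB.
rewrite (submx_trans vB BB').
case: ifP => [wB|/negbT wB]; first by rewrite (submx_trans wB BB').
case: ifP => // _; rewrite /wt ifT //.
by apply: contraNneq wB => ->; rewrite sub0mx.
Qed.

Lemma len_in_subset m m' (B : 'M[k]_(m, n)) (B' : 'M[k]_(m', n)) z :
  (B <= B')%MS -> (len_in B z <= len_in B' z)%N.
Proof. by move=> BB'; apply: leq_sum => i _; apply: wt_in_subset. Qed.

(** A further point of the scheme, or a tangent direction at a point of B, can
    be added to B. *)
Lemma len_in_extend m (B : 'M[k]_(m, n)) z :
  ~~ within B z ->
  exists u : 'rV[k]_n, (len_in B z < len_in (col_mx u B) z)%N.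
Proof.
case/forallPn => i; rewrite negb_imply wt_eq0 negb_and => /andP[nz nB].
suff [u hu] : exists u : 'rV[k]_n, (wt_in B z i < wt_in (col_mx u B) z i)%N.
  exists u; rewrite /len_in (bigD1 i) //= [X in (_ < X)%N](bigD1 i) //= -addSn.
  apply: (leq_add hu); apply: leq_sum => j _.
  exact: wt_in_subset (sub_colr _ _).
move: nB; rewrite /wt_in; have [vB /= wB|vB _] := boolP (v i <= B)%MS.
  exists (z i).2; rewrite (submx_trans vB (sub_colr _ _)) sub_coll (negbTE wB).
  rewrite /wt ifT //.
  by apply: contraNneq wB => ->; rewrite sub0mx.
by exists (v i); rewrite /= sub_coll; case: ifP => // _; rewrite lt0n wt_eq0.
Qed.

(** A scheme of length at least m has length at least m on some space spanned by
    m vectors. *)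
Lemma len_in_pick m z :
  exists B : 'M[k]_(m, n), (minn m (len z) <= len_in B z)%N.
Proof.
elim: m => [|m [B hB]]; first by exists 0; rewrite min0n.
have [wB|/len_in_extend[u hu]] := boolP (within B z).
  exists (col_mx 0 B : 'M_(1 + m, n)).
  rewrite (leq_trans (geq_minr _ _)) // -(len_in_within wB).
  apply: len_in_subset; exact: sub_colr.
exists (col_mx u B : 'M_(1 + m, n)); apply: leq_trans hu; lia.
Qed.


Hypothesis v_neq0 : forall i, v i != 0.
Hypothesis v_inj : forall i j, (v i <= v j)%MS -> i = j.

Lemma len_neq0 z : (len z != 0)%N -> exists i, z i != 0.
Proof.
move=> nz; apply/existsP; apply: contraR nz => /existsPn h.
by apply/len_eq0P => i; apply/eqP; move: (h i); rewrite negbK.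
Qed.

Lemma wt_le_len z i : (wt (z i) <= len z)%N.
Proof. by rewrite /len (bigD1 i) //= leq_addr. Qed.

(** A hyperplane through one point and not containing the whole scheme leaves a
    nonzero relation which is shorter by one in degree one less.  Such a
    hyperplane exists unless the scheme is one reduced point, where a power of a
    linear form not vanishing there is not killed. *)
Lemma kills_short d z :
  kills d z -> tangent z -> (len z <= d.+1)%N -> len z = 0%N.
Proof.
elim: d z => [|d IH] z kz tz le; apply/eqP; apply: contraT => /len_neq0[i nzi].
  have wi : (0 < wt (z i))%N by rewrite lt0n wt_eq0.
  move: le; rewrite /len (bigD1 i) //= => le.
  have wi1 : wt (z i) = 1%N by lia.
  have : (\sum_(j | j != i) wt (z j) == 0)%N by lia.
  rewrite sum_nat_eq0 => /forallP h.
  move: kz; rewrite /= (bigD1 i) //= big1 ?addr0; last first.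
    by move=> j ji; move: (implyP (h j) ji); rewrite wt_eq0 => /eqP->.
  by move=> a0; move: wi1; rewrite /wt a0 eqxx; case: ifP.
have [wB|/not_within_residual[l [Bl]]] := boolP (within (v i) z).
  have [l [_ lv]] : exists l, (0 : 'M[k]_n) *m l = 0 /\ lval l (v i) != 0.
    by apply: separate; rewrite submx0.
  have /eqP : len (residual l z) = 0%N.
    apply: IH (kz l) (tangent_residual tz) _; rewrite /len (bigD1 i) //= big1.
      rewrite addn0 (leq_trans (wt_residual_le _ _ _)) // /wt.
      have [_|/tz] := eqVneq (z i).2 0; first by case: (_ != _).
      by case: (withinP _ _ wB i nzi) => _ ->.
    move=> j ji; apply/eqP; rewrite wt_eq0 residual0 //; apply/eqP.
    by apply: contraNT ji => /(withinP _ _ wB)[/v_inj->].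
  move/len_eq0P/(_ i)/eqP; rewrite -wt_eq0 wt_residual // wt_eq0.
  by rewrite (negbTE nzi).
move/negP; case; apply/eqP/(IH _ (kz l) (tangent_residual tz)).
have := len_in_residual z Bl; suff : (0 < len_in (v i) z)%N by lia.
rewrite /len_in (bigD1 i) //= ltn_addr // /wt_in submx_refl.
by case: ifP => // _; rewrite lt0n wt_eq0.
Qed.

(** A hyperplane through a subscheme of length 2 leaves a relation in degree
    d - 1, on some line B by induction, and of length more than d by
    [kills_short].  Any hyperplane through B then leaves too little for a
    nonzero relation, so it contains the scheme. *)
Lemma kills_collinear d z :
  kills d z -> tangent z -> (len z <= d.*2.+1)%N ->
  exists B : 'M[k]_(2, n), within B z.
Proof.
elim: d z => [|d IH] z kz tz le.
  exists 0; apply/withinP => i; rewrite (len_eq0P _ _) ?eqxx //.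
  exact/eqP/(kills_short kz).
have [B0 hB0] := len_in_pick 2 z.
have [|/not_within_residual[l [Bl nz]]] := boolP (within B0 z).
  by exists B0.
have hl := len_in_residual z Bl.
have [B hB] : exists B : 'M[k]_(2, n), within B (residual l z).
  apply: IH (kz l) (tangent_residual tz) _; lia.
exists B; apply: contraT => /not_within_residual[l' [Bl' /eqP[]]].
apply: kills_short (kz l') (tangent_residual tz) _.
have := len_in_residual z Bl'; have := len_in_residual_le B l z.
rewrite (len_in_within hB).
suff : (d.+1 < len (residual l z))%N by lia.
rewrite ltnNge; apply: contraNN nz => h; apply/eqP.
exact: kills_short (kz l) (tangent_residual tz) h.
Qed.

(** By induction a residual meets a plane B1 in length at least d + 1, and so
    does the residual with respect to B1 a plane B2; what both leave is shorter
    than any nonzero relation in degree d - 2.  So the residual with respect to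
    B1 lies on B2.  Unless B2 reaches length d + 2, this residual has length
    exactly d + 1 and is collinear, and its line together with one more point
    or direction spans the wanted plane. *)
Lemma kills_plane d z :
  kills d z -> tangent z -> (len z <= 3 * d + 1)%N -> (len z != 0)%N ->
  exists B : 'M[k]_(3, n), (d + 2 <= len_in B z)%N.
Proof.
elim/ltn_ind: d z => d IH z kz tz le nz.
have lt : (d + 2 <= len z)%N.
  rewrite addn2 ltnNge; apply: contraNN nz => h; apply/eqP.
  exact: kills_short kz tz h.
(* For d = 1 a plane of length 3 is already enough. *)
have [B0 hB0] := len_in_pick 3 z.
have full m (B : 'M[k]_(m, n)) : within B z -> (d + 2 <= len_in B z)%N.
  by move/len_in_within->.
case: d => [|[|e]] in IH kz le lt full *; [lia|exists B0; lia|].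
case wB0 : (within B0 z); first by exists B0; exact: full.
have [l0 [Bl0 nz0]] := not_within_residual (negbT wB0).
have h0 := len_in_residual z Bl0; set z0 := residual l0 z in nz0 h0.
have [||B1 hB1] := IH e.+1 _ z0 (kz l0) (tangent_residual tz) _ nz0; try lia.
have c1 := len_in_residual_le B1 l0 z; rewrite -/z0 in c1.
case wB1 : (within B1 z); first by exists B1; exact: full.
have [l1 [Bl1 nz1]] := not_within_residual (negbT wB1).
have h1 := len_in_residual z Bl1; set z1 := residual l1 z in nz1 h1.
have t1 : tangent z1 by exact: tangent_residual.
have [||B2 hB2] := IH e.+1 _ z1 (kz l1) t1 _ nz1; try lia.
have c2 := len_in_residual_le B2 l1 z; rewrite -/z1 in c2.
(* What B2 leaves of z1 has length at most d - 1 in degree d - 2. *)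
have wB2 : within B2 z1.
  apply: contraT => /not_within_residual[l2 [Bl2 /eqP[]]].
  apply: (@kills_short e) (kz l1 l2) (tangent_residual t1) _.
  by have := len_in_residual z1 Bl2; rewrite -/z1; lia.
have e1 := len_in_within wB2.
have [big|small] := leqP (e.+2 + 2) (len_in B2 z); first by exists B2.
have [|B wB] := @kills_collinear e.+1 z1 (kz l1) t1; first by lia.
have b1 : (e.+2 < len z1)%N.
  rewrite ltnNge; apply: contraNN nz1 => h; apply/eqP.
  exact: (@kills_short e.+1) (kz l1) t1 h.
have cB := len_in_residual_le B l1 z; rewrite -/z1 (len_in_within wB) in cB.
case wBz : (within B z).
  exists (col_mx 0 B : 'M_(1 + 2, n)).
  by rewrite (leq_trans (full _ _ wBz)) // len_in_subset // sub_colr.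
have [u hu] := len_in_extend (negbT wBz).
exists (col_mx u B : 'M_(1 + 2, n)); apply: leq_trans hu; lia.
Qed.


Lemma rank_pair (u w : 'rV[k]_n) :
  w != 0 -> ~~ (u <= w)%MS -> (1 < \rank (col_mx u w))%N.
Proof.
move=> w0 uw; apply: leq_trans (_ : (\rank w < \rank (col_mx u w))%N).
  by rewrite rank_rV w0.
by apply: rank_ltmx; rewrite ltmxE sub_colr col_mx_sub negb_and uw.
Qed.

Lemma len_within m (B : 'M[k]_(m, n)) z :
  within B z -> len z = (\sum_(i | (v i <= B)%MS) wt (z i))%N.
Proof.
move/withinP => wB; rewrite /len [LHS](bigID (fun i => (v i <= B)%MS)) /=.
rewrite [X in (_ + X)%N]big1 ?addn0 // => i vB; apply/eqP; rewrite wt_eq0.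
by apply: contraNT vB => /wB[].
Qed.

(** Each of the at most (d + 1)/2 points on L contributes at most 2 to a length
    exceeding d, so all contributions are equal to 2. *)
Lemma full_line d m (L : 'M[k]_(m, n)) l z :
  within L (residual l z) -> (d < len (residual l z))%N ->
  (2 * #|[pred i | (v i <= L)%MS]| <= d.+1)%N ->
  forall i, (v i <= L)%MS ->
  [/\ lval l (v i) != 0, wt (z i) = 2%N & ((z i).2 <= L)%MS].
Proof.
move=> wL; rewrite (len_within wL) => big card i vL.
set y := residual l z in wL big.
have yi : wt (y i) = 2%N.
  have cardE : #|[pred j | (v j <= L)%MS]| = (\sum_(j | (v j <= L)%MS) 1)%N.
    by rewrite -sum1_card.
  move: big card; rewrite cardE (bigD1 i) //= [in (2 * _)%N](bigD1 i) //=.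
  have : (\sum_(j | (v j <= L)%MS && (j != i)) wt (y j) <=
          2 * \sum_(j | (v j <= L)%MS && (j != i)) 1)%N.
    by rewrite big_distrr; apply: leq_sum => j _; exact: wt_le2.
  by have := wt_le2 (y i); lia.
have lv : lval l (v i) != 0.
  apply/negP => /eqP lv; move: yi; rewrite /wt /y /residual /= lv scale0r eqxx.
  by case: (_ != 0).
have [] := withinP _ _ wL i; first by rewrite -wt_eq0 yi.
rewrite /y /residual /= (eqmx_scale _ lv) => _ wL'; split=> //.
by rewrite -yi wt_residual.
Qed.

Lemma len_split (A : {pred I}) z y :
  (forall i, i \in A -> y i = 0) -> (forall i, wt (y i) <= wt (z i))%N ->
  (len y + \sum_(i in A) wt (z i) <= len z)%N.
Proof.
move=> yA yz; rewrite /len [X in (X + _)%N](bigID (mem A)) /=.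
rewrite [X in (_ <= X)%N](bigID (mem A)) /= addnC addnA leq_add //.
  rewrite [X in (_ + X)%N]big1 ?addn0 // => i /yA->.
  by apply/eqP; rewrite wt_eq0.
by apply: leq_sum.
Qed.

(** A plane l = 0 leaves a relation on a line L, and a plane l' = 0 through L
    one on a second line R.  All points on both lines are double for z, so that
    a product of two linear forms which kills the points of L and R, or those
    of R and one of L, leaves less than a nonzero relation needs. *)
Theorem no_spanning_relation d z :
  (2 <= d)%N -> kills d z -> tangent z -> (len z <= 3 * d + 1)%N ->
  (forall i, z i != 0) ->
  (forall B : 'M[k]_(3, n), exists i, ~~ (v i <= B)%MS) ->
  (forall B : 'M[k]_(2, n), 2 * #|[pred i | (v i <= B)%MS]| <= d.+1)%N ->
  False.
Proof.
case: d => [|[|e]] // _ kz tz le nz span lines.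
(* All points carry the relation, so no plane contains its scheme. *)
have notin m (B : 'M[k]_(m, n)) : (m <= 3)%N -> ~~ within B z.
  move=> m3; pose C : 'M[k]_(m + (3 - m), n) := col_mx B 0.
  have BC : (B <= C)%MS by rewrite -addsmxE addsmxSl.
  move: C BC; rewrite subnKC // => C BC.
  have [i vi] := span C; apply/withinP => /(_ i (nz i))[vB _].
  by move/negP: vi; apply; exact: submx_trans vB BC.
have nz' : (len z != 0)%N.
  have [i _] := span 0; rewrite -lt0n (leq_trans _ (wt_le_len z i)) //.
  by rewrite lt0n wt_eq0.
(* A plane of length at least d + 2 has its residual on a line. *)
have line l : (e.+2 + 2 + len (residual l z) <= len z)%N ->
    (len (residual l z) != 0)%N ->
    exists L : 'M[k]_(2, n), within L (residual l z) /\
                             (e.+2 < len (residual l z))%N.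
  move=> short y0; have ty := tangent_residual tz (l := l).
  have [|L wL] := @kills_collinear e.+1 _ (kz l) ty; first by lia.
  exists L; split=> //; rewrite ltnNge; apply: contraNN y0 => h; apply/eqP.
  exact: (@kills_short e.+1) (kz l) ty h.
have [B hB] := kills_plane kz tz le nz'.
have [l [Bl ly]] := not_within_residual (notin _ B isT).
have hl := len_in_residual z Bl.
have [|L [wL bigL]] := line l _ ly; first by lia.
have fullL := full_line wL bigL (lines L).
have cL := len_in_residual_le L l z; rewrite (len_in_within wL) in cL.
have [u hu] := len_in_extend (notin _ L isT).
have [l' [Bl' ly']] := not_within_residual (notin _ (col_mx u L) isT).
have hl' := len_in_residual z Bl'.
have [|R [wR bigR]] := line l' _ ly'; first by lia.
have fullR := full_line wR bigR (lines R).
have Ll' : L *m l' = 0.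
  by move: Bl'; rewrite mul_col_mx => /eqP; rewrite col_mx_eq0 => /andP[_ /eqP].
(* The points on R survive the multiplication by l', which vanishes on L. *)
have disj i : (v i <= R)%MS -> ~~ (v i <= L)%MS.
  by case/fullR => + _ _; apply: contraNN => /(lval_sub Ll')->.
have twoL (T : 'M[k]_(2, n)) l0 : within T (residual l0 z) ->
    (e.+2 < len (residual l0 z))%N ->
    (e.+2 < \sum_(i | (v i <= T)%MS) wt (z i))%N.
  move=> wT bigT; apply: leq_trans bigT _; rewrite (len_within wT).
  by apply: leq_sum => i _; exact: wt_residual_le.
(* The residual with respect to p = 0 and q = 0 misses the points of L and of R,
   each carrying length more than d. *)
have cover i : (v i <= L)%MS || (v i <= R)%MS.
  apply/orP; case: (boolP (v i <= L)%MS) => [|nL]; [by left|right].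
  apply: contraT => nR.
  have [p [Lp pi]] := separate nL; have [q [Rq qi]] := separate nR.
  set y := residual q (residual p z).
  have : len y = 0%N.
    apply: (@kills_short e) (kz p q) _ _.
      by do 2 apply: tangent_residual.
    suff : (len y + \sum_(j | (v j <= L)%MS || (v j <= R)%MS) wt (z j)
             <= len z)%N.
      rewrite (bigID (fun j => (v j <= L)%MS)) /=.
      have := twoL _ _ wL bigL; have := twoL _ _ wR bigR.
      rewrite [X in (_ + (X + _) <= _)%N](eq_bigl (fun j => (v j <= L)%MS)).
        rewrite [X in (_ + (_ + X) <= _)%N](eq_bigl (fun j => (v j <= R)%MS)).
          by rewrite -/y; lia.
        move=> j /=; case: (boolP (v j <= R)%MS) => [/disj/negbTE->//|_].
        by rewrite orbF andbN.
      by move=> j /=; case: (_ <= L)%MS; rewrite ?andbF.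
    apply: (@len_split (fun j => (v j <= L)%MS || (v j <= R)%MS)) => j.
      rewrite unfold_in /= /y; case/orP => vj.
        apply: residual0; have [_ _ wj] := fullL _ vj.
        exact: residual_within Lp vj wj.
      have [_ _ wj] := fullR _ vj.
      apply: residual_within Rq vj _; rewrite /residual /= scalemx_sub //.
    exact: leq_trans (wt_residual_le _ _ _) (wt_residual_le _ _ _).
  move/eqP/len_eq0P/(_ i)/eqP; rewrite -wt_eq0 /y !wt_residual // wt_eq0.
  by rewrite (negbTE (nz i)).
have sumL : (\sum_(i | (v i <= L)%MS) wt (z i) <=
             2 * #|[pred i | (v i <= L)%MS]|)%N.
  have -> : #|[pred j | (v j <= L)%MS]| = (\sum_(j | (v j <= L)%MS) 1)%N.
    by rewrite -sum1_card.
  by rewrite big_distrr; apply: leq_sum => j _; exact: wt_le2.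
(* Two points of L, to be separated by a form m vanishing on R. *)
have /card_gt1P[i1 [i0 [v1 v0 ne]]] : (1 < #|[pred i | (v i <= L)%MS]|)%N.
  by have := twoL _ _ wL bigL; lia.
rewrite !inE /= in v0 v1.
(* Otherwise the plane spanned by R and v_i1 would contain L, hence S. *)
have v0n : ~~ (v i0 <= col_mx (v i1) R)%MS.
  have [j vj] := span (col_mx (v i1) R : 'M_(1 + 2, n)).
  apply: contra vj => v0R.
  have v1R : (v i1 <= col_mx (v i1) R)%MS by exact: sub_coll.
  case/orP: (cover j) => vj; last exact: submx_trans vj (sub_colr _ _).
  apply: submx_trans vj _.
  apply: (submx_trans (_ : L <= col_mx (v i0) (v i1))%MS _); last first.
    by rewrite col_mx_sub v0R v1R.
  have sub : (col_mx (v i0) (v i1) <= L)%MS by rewrite col_mx_sub v0 v1.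
  have /mxrank_leqif_sup[_ <-] // := sub.
  rewrite eqn_leq mxrankS //= (leq_trans (rank_leq_row L)) //.
  by apply: rank_pair => //; apply: contra ne => /v_inj->.
have [m [Bm m0]] := separate v0n.
have [m1 Rm] : lval m (v i1) = 0 /\ R *m m = 0.
  move: (Bm); rewrite mul_col_mx => /eqP; rewrite col_mx_eq0.
  by case/andP => _ /eqP->; split=> //; apply: lval_sub Bm (sub_coll _ _).
set y := residual m (residual m z).
have : len y = 0%N.
  apply: (@kills_short e) (kz m m) _ _.
    by do 2 apply: tangent_residual.
  have h : (len y <= 2 * \sum_(j | (v j <= L)%MS && (j != i1)) 1)%N.
    rewrite big_distrr big_mkcond /=; apply: leq_sum => j _.
    case: ifP => [_|/negbT]; first exact: wt_le2.
    rewrite negb_and negbK leqn0 wt_eq0; case: eqP => [->|_] /=.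
      rewrite orbT => _; apply/eqP/residual_van => //=.
      by rewrite m1 scale0r lval0.
    rewrite orbF => /negbTE nL; move: (cover j); rewrite nL /= => vR.
    rewrite /y residual0 //; have [_ _ wj] := fullR _ vR.
    exact: residual_within Rm vR wj.
  have := lines L; rewrite (cardD1 i1) inE v1 /=.
  suff -> : #|[predD1 [pred i | (v i <= L)%MS] & i1]| =
     (\sum_(j | (v j <= L)%MS && (j != i1)) 1)%N.
    by move: h; rewrite -/y; lia.
  by rewrite -sum1_card; apply: eq_bigl => j; rewrite !inE andbC.
move/eqP/len_eq0P/(_ i0)/eqP; rewrite -wt_eq0 /y !wt_residual // wt_eq0.
by rewrite (negbTE (nz i0)).
Qed.


(** The value of z on the product of the linear forms in ls. *)
Definition total ls z : k :=
  \sum_i (foldl (fun y l => residual l y) z ls i).1.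

Definition lincomb (c : k) (x y : k * 'rV[k]_n) : k * 'rV[k]_n :=
  (c * x.1 + y.1, c *: x.2 + y.2).

Lemma lincomb0 c x : x = 0 -> lincomb c x x = x.
Proof. by move=> ->; rewrite /lincomb /= mulr0 scaler0 !addr0. Qed.

Lemma residual_linear l c z z1 z2 i : z i = lincomb c (z1 i) (z2 i) ->
  residual l z i = lincomb c (residual l z1 i) (residual l z2 i).
Proof.
rewrite /residual => ->; congr (_, _); rewrite /= ?lvalD ?lvalZ.
  by rewrite mulrDl mulrDr addrACA mulrA.
by rewrite scalerDr !scalerA mulrC.
Qed.

Lemma total_linear ls c z z1 z2 : (forall i, z i = lincomb c (z1 i) (z2 i)) ->
  total ls z = c * total ls z1 + total ls z2.
Proof.
rewrite /total; elim: ls z z1 z2 => [|l ls IH] z z1 z2 h /=; last first.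
  by apply: IH => i; apply: residual_linear.
by rewrite big_distrr -big_split; apply: eq_bigr => i _; rewrite h.
Qed.

Lemma total0 ls : total ls (fun=> 0) = 0.
Proof.
rewrite (@total_linear ls (-1) (fun=> 0) (fun=> 0) (fun=> 0)).
  by rewrite mulN1r addNr.
by move=> i; rewrite lincomb0.
Qed.

Lemma total_eq ls z z' : z =1 z' -> total ls z = total ls z'.
Proof.
move=> h; rewrite (@total_linear ls 1 z z' (fun=> 0)) ?total0 ?mul1r ?addr0 //.
by move=> i; rewrite h /lincomb mul1r scale1r !addr0; case: (z' i).
Qed.

Lemma residualC l l' z :
  residual l (residual l' z) =1 residual l' (residual l z).
Proof.
move=> i; rewrite /residual /= !lvalZ !scalerA.
congr (_, _); last by rewrite mulrC.
ring.
Qed.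

Lemma total_nseqC l l' j ls z :
  total (l :: nseq j l' ++ ls) z = total (nseq j l' ++ l :: ls) z.
Proof.
elim: j z => [//|j IH] z; rewrite [nseq _ _ ++ _]/= [in RHS]/=.
rewrite -[RHS]/(total (nseq j l' ++ l :: ls) (residual l' z)) -IH.
exact: total_eq (residualC _ _ _).
Qed.

Lemma linear_kernel m p (f : 'rV[k]_m -> 'rV[k]_p) :
  linear f -> (p < m)%N -> exists2 y, y != 0 & f y = 0.
Proof.
move=> lf pm.
pose F : {linear 'rV[k]_m -> 'rV[k]_p} :=
  HB.pack f (GRing.isLinear.Build _ _ _ _ f lf).
have /rowV0Pn[y yk y0] : kermx (lin1_mx F) != 0.
  rewrite -mxrank_eq0 mxrank_ker -lt0n subn_gt0.
  exact: leq_ltn_trans (rank_leq_col _) pm.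
exists y => //; rewrite -[f y]/(F y) -mul_rV_lin1; apply/sub_kermxP; exact: yk.
Qed.

Section Line.

Variables (p q : 'rV[k]_n) (lp lq : 'cV[k]_n).
Hypotheses (lpp : lval lp p = 1) (lpq : lval lp q = 0).
Hypotheses (lqp : lval lq p = 0) (lqq : lval lq q = 1).

Lemma lval_line l u : (u <= col_mx p q)%MS ->
  lval l u = lval l p * lval lp u + lval l q * lval lq u.
Proof.
rewrite -addsmxE => /sub_addsmxP[[a b] ->] /=.
rewrite [a]mx11_scalar [b]mx11_scalar !mul_scalar_mx !lvalD !lvalZ.
rewrite lpp lpq lqp lqq !(mulr0, mulr1, add0r, addr0).
by rewrite mulrC [X in _ + X]mulrC.
Qed.

Lemma residual_line l z i : within (col_mx p q) z ->
  residual l z i =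
  lincomb (lval l p) (residual lp z i) (lincomb (lval l q) (residual lq z i) 0).
Proof.
move/withinP=> wz; have [zi|/wz[vi wi]] := eqVneq (z i) 0.
  by rewrite !residual0 // !lincomb0.
rewrite /lincomb /= !addr0 /residual (lval_line l vi) (lval_line l wi).
congr (_, _) => /=.
  rewrite mulrDr !mulrDr addrACA; congr (_ + _ + (_ + _)); exact: mulrCA.
by rewrite scalerDl !scalerA.
Qed.

Lemma within_residual m (B : 'M[k]_(m, n)) l z :
  within B z -> within B (residual l z).
Proof.
move/withinP=> wz; apply/withinP => i.
have [/(residual0 l)->|/wz[vi wi] _] := eqVneq (z i) 0; first by rewrite eqxx.
by rewrite scalemx_sub.
Qed.

(** On a line only the d + 1 monomials in the two coordinate forms matter. *)
Lemma kills_line d z : within (col_mx p q) z ->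
  (forall j, (j <= d)%N -> total (nseq j lp ++ nseq (d - j) lq) z = 0) ->
  kills d z.
Proof.
elim: d z => [|d IH] z wz h; first by move: (h 0 isT).
move=> l; apply: IH => [|j jd]; first exact: within_residual.
rewrite (@total_linear _ (lval l p) _ (residual lp z)
  (fun i => lincomb (lval l q) (residual lq z i) 0)); last first.
  by move=> i; exact: residual_line.
rewrite (@total_linear _ (lval l q)
  (fun i => lincomb (lval l q) (residual lq z i) 0)
  (residual lq z) (fun=> 0)) //.
have -> : total (nseq j lp ++ nseq (d - j) lq) (residual lp z) = 0.
  by have := h j.+1 jd; rewrite subSS.
rewrite -[total _ (residual lq z)]/(total (lq :: nseq j lp ++ _) z) total_nseqC.
have := h j (leqW jd); rewrite subSn // => ->.
by rewrite total0 !mulr0 !addr0.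
Qed.

End Line.

(** At each of the a points of A there are two functionals, the value and one
    derivative along the line; a combination of these 2a functionals has to
    satisfy the d + 1 equations of [kills_line]. *)
Lemma line_relation d (B : 'M[k]_(2, n)) (A : {set I}) :
  (forall i, i \in A -> (v i <= B)%MS) -> (1 < #|A|)%N ->
  (d.+1 < 2 * #|A|)%N ->
  exists z, [/\ tangent z, kills d z, (exists i, z i != 0) &
                forall i, i \notin A -> z i = 0].
Proof.
move=> AB /card_gt1P[a [b [aA bA ab]]] big.
have lin i j : i != j -> exists l, lval l (v i) = 1 /\ lval l (v j) = 0.
  move=> ij; have [|l [jl nz]] := @separate _ (v j) (v i).
    by apply: contra ij => /v_inj->.
  have lvalP c u : lval (c *: l) u = c * lval l u.
    by rewrite /lval -scalemxAr mxE.
  exists ((lval l (v i))^-1 *: l); rewrite !lvalP mulVf //.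
  by rewrite (lval_sub jl (submx_refl _)) mulr0.
have [lp [lpp lpq]] := lin a b ab; have [|lq [lqq lqp]] := lin b a.
  by rewrite eq_sym.
(* The line is spanned by the points a and b of A, which also serve as
   directions for the derivatives. *)
have BL : (B <= col_mx (v a) (v b))%MS.
  have sub : (col_mx (v a) (v b) <= B)%MS by rewrite col_mx_sub !AB.
  have /mxrank_leqif_sup[_ <-] // := sub.
  rewrite eqn_leq mxrankS //= (leq_trans (rank_leq_row B)) //.
  by apply: rank_pair => //; apply: contra ab => /v_inj->.
pose t i := if i == a then v b else v a.
pose r := enum_rank_in aA.
pose Z (y : 'rV[k]_(#|A| + #|A|)) : functional := fun i =>
  if i \in A then (y 0 (lshift _ (r i)), y 0 (rshift _ (r i)) *: t i) else 0.
have tA i : i \in A -> (t i <= col_mx (v a) (v b))%MS.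
  by rewrite /t; case: ifP => _ _; rewrite (submx_trans _ BL) // AB.
have wZ y : within (col_mx (v a) (v b)) (Z y).
  apply/withinP => i; rewrite /Z; case: ifP => [iA _|_]; last by rewrite eqxx.
  by rewrite (submx_trans (AB _ iA) BL) scalemx_sub // tA.
have tZ y : tangent (Z y).
  move=> i; rewrite /Z; case: ifP => iA /=; last by rewrite eqxx.
  rewrite scaler_eq0 negb_or => /andP[nz _]; rewrite (eqmx_scale _ nz).
  rewrite /t; case: eqP => [->|/eqP ia]; apply/negP => /v_inj.
    by move/eqP; rewrite eq_sym (negbTE ab).
  by move/eqP; rewrite eq_sym (negbTE ia).
pose f (y : 'rV[k]_(#|A| + #|A|)) : 'rV[k]_d.+1 :=
  \row_j total (nseq j lp ++ nseq (d - j) lq) (Z y).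
have [||y y0 fy] := @linear_kernel _ _ f.
- move=> c y y'; apply/rowP => j; rewrite !mxE; apply: total_linear => i.
  rewrite /Z; case: ifP => _; last by rewrite lincomb0.
  by rewrite /lincomb !mxE; congr (_, _) => //=; rewrite scalerDl scalerA.
- by rewrite addnn -mul2n.
exists (Z y); split=> //; last by move=> i /negbTE iA; rewrite /Z iA.
  apply: (kills_line lpp lpq lqp lqq) => // j jd.
  by move/rowP: fy => /(_ (Ordinal (jd : (j < d.+1)%N))); rewrite !mxE.
apply/existsP; apply: contraR y0 => /existsPn h; apply/eqP/rowP => j.
rewrite mxE; have zero i : i \in A ->
    y 0 (lshift _ (r i)) = 0 /\ y 0 (rshift _ (r i)) = 0.
  move=> iA; move: (h i); rewrite negbK /Z iA xpair_eqE scaler_eq0 /t.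
  case/andP=> /eqP-> /orP[/eqP->//|].
  by case: ifP => _; rewrite (negbTE (v_neq0 _)).
rewrite -[j]splitK; case: (split j) => s /=; have sA := enum_valP s;
  have [+ +] := zero _ sA; by rewrite /r enum_valK_in.
Qed.

End FirstOrderFunctionals.

(** * Polynomials and their first-order values *)

Section Polynomials.

Variables (k : fieldType) (n : nat).

Implicit Types (F G : {mpoly k[n]}) (u w : 'rV[k]_n) (l : 'cV[k]_n).

Definition at_row F u : k := F.@[fun i => u 0 i].

Definition along w F u : k := \sum_i w 0 i * at_row F^`M(i) u.

Definition lform l : {mpoly k[n]} := \sum_i l i 0 *: 'X_i.

Definition evaluate (I : finType) (v : I -> 'rV[k]_n) (z : functional k n I)
    F i :=
  (z i).1 * at_row F (v i) + along (z i).2 F (v i).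

Lemma at_rowM F G u : at_row (F * G) u = at_row F u * at_row G u.
Proof. exact: mevalM. Qed.

Lemma at_rowD F G u : at_row (F + G) u = at_row F u + at_row G u.
Proof. exact: mevalD. Qed.

Lemma at_rowN F u : at_row (- F) u = - at_row F u.
Proof. exact: mevalN. Qed.

Lemma at_rowZ c F u : at_row (c *: F) u = c * at_row F u.
Proof. exact: mevalZ. Qed.

Lemma at_rowE F m u : at_row (F ^+ m) u = at_row F u ^+ m.
Proof. exact: rmorphXn. Qed.

Lemma at_row1 u : at_row 1 u = 1.
Proof. exact: meval1. Qed.

Lemma at_rowX i u : at_row 'X_i u = u 0 i.
Proof. exact: mevalXU. Qed.

Lemma at_row_lform l u : at_row (lform l) u = lval l u.
Proof.
rewrite /at_row raddf_sum /lval mxE; apply: eq_bigr => i _.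
by rewrite /= mevalZ mevalXU mulrC.
Qed.

Lemma mderivXU i j : ('X_j)^`M(i) = (i == j)%:R :> {mpoly k[n]}.
Proof.
rewrite mderivX mnm1E eq_sym; case: eqP => [->|_]; last by rewrite scale0r.
have -> : (U_(j) - U_(j))%MM = 0%MM.
  by apply/mnmP => a; rewrite mnmBE subnn mnm0E.
by rewrite mpolyX0 scale1r.
Qed.

Lemma mderiv_lform l i : (lform l)^`M(i) = (l i 0)%:MP.
Proof.
rewrite /lform raddf_sum (bigD1 i) //= big1 => [|j ji].
  by rewrite mderivZ mderivXU eqxx addr0 -mul_mpolyC mulr1.
by rewrite mderivZ mderivXU eq_sym (negbTE ji) scaler0.
Qed.

Lemma along_lform w l u : along w (lform l) u = lval l w.
Proof.
rewrite /along /lval mxE; apply: eq_bigr => i _.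
by rewrite mderiv_lform /at_row mevalC.
Qed.

Lemma alongM w F G u :
  along w (F * G) u = along w F u * at_row G u + at_row F u * along w G u.
Proof.
rewrite /along mulr_suml mulr_sumr -big_split; apply: eq_bigr => i _.
by rewrite mderivM at_rowD !at_rowM /=; ring.
Qed.

Lemma along_linear w c F G u :
  along w (c *: F + G) u = c * along w F u + along w G u.
Proof.
rewrite /along mulr_sumr -big_split; apply: eq_bigr => i _.
by rewrite mderivD mderivZ at_rowD at_rowZ /=; ring.
Qed.

Lemma along0 w u : along w 0 u = 0.
Proof.
by have := along_linear w (-1) 0 0 u; rewrite scaler0 addr0 mulN1r addNr.
Qed.

Lemma alongZl c w F u : along (c *: w) F u = c * along w F u.
Proof.
by rewrite /along mulr_sumr; apply: eq_bigr => i _; rewrite mxE mulrA.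
Qed.

Lemma evaluate_lform (I : finType) (v : I -> 'rV[k]_n) z l G i :
  evaluate v z (lform l * G) i = evaluate v (residual v l z) G i.
Proof.
rewrite /evaluate /residual /= alongM at_rowM alongZl at_row_lform along_lform.
ring.
Qed.

Lemma evaluate_linear (I : finType) (v : I -> 'rV[k]_n) z c F G i :
  evaluate v z (c *: F + G) i = c * evaluate v z F i + evaluate v z G i.
Proof. by rewrite /evaluate along_linear at_rowD at_rowZ; ring. Qed.

Lemma evaluate0 (I : finType) (v : I -> 'rV[k]_n) z i : evaluate v z 0 i = 0.
Proof. by rewrite /evaluate /at_row along0 meval0 mulr0 addr0. Qed.

Lemma dhomog_ind (P : nat -> {mpoly k[n]} -> Prop) :
  (forall d, P d 0) ->
  (forall d c F G, P d F -> P d G -> P d (c *: F + G)) ->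
  P 0 1 -> (forall d i F, P d F -> P d.+1 ('X_i * F)) ->
  forall d F, F \is d.-homog -> P d F.
Proof.
move=> P0 Plin P1 PX d F hF.
have mono m : P (mdeg m) 'X_[m].
  move: {2}(mdeg m) (erefl (mdeg m)) => e; elim: e m => [|e IH] m me.
    by move/eqP: me; rewrite mdeg_eq0 => /eqP->; rewrite mdeg0 mpolyX0.
  have [i mi] : exists i, m i != 0%N.
    apply/existsP; apply: contraTT (_ : mdeg m != 0) => [/existsPn h|].
      2: by rewrite me.
    rewrite negbK mdeg_eq0; apply/eqP/mnmP => i; rewrite mnm0E; apply/eqP.
    by move: (h i); rewrite negbK.
  have mE : m = (U_(i) + (m - U_(i)))%MM by rewrite addmC submK // lep1mP.
  rewrite mE mpolyXD mdegD mdeg1 add1n; apply/PX/IH.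
  by move: me; rewrite [in mdeg m]mE mdegD mdeg1; case.
rewrite [F]mpolyE; elim: (msupp F) (dhomogP _ _ _ hF) => [|m s IH] hs.
  by rewrite big_nil.
rewrite big_cons; apply: Plin; last first.
  by apply: IH => j js; rewrite hs ?inE ?js ?orbT.
by rewrite -(hs m) ?inE ?eqxx //; exact: mono.
Qed.

Lemma X_lform i : 'X_i = lform (delta_mx i 0).
Proof.
rewrite /lform (bigD1 i) //= big1 => [|j ji];
  rewrite !mxE ?eqxx ?scale1r ?addr0 //.
by rewrite (negbTE ji) scale0r.
Qed.

Lemma homogX i : ('X_i : {mpoly k[n]}) \is 1.-homog.
Proof. by rewrite dhomogX; apply/eqP; exact: mdeg1. Qed.

Lemma homogXn i m : ('X_i ^+ m : {mpoly k[n]}) \is m.-homog.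
Proof. by rewrite -{2}[m]mul1n; apply/dhomogMn/homogX. Qed.

Lemma homog_lform l : lform l \is 1.-homog.
Proof. by apply: rpred_sum => i _; apply: dhomogZ; exact: homogX. Qed.

(** By [evaluate_lform] both sides behave in the same way under multiplication
    by linear forms, and products of variables span all forms. *)
Lemma kills_evaluate (I : finType) (v : I -> 'rV[k]_n) d z :
  kills v d z <-> (forall F, F \is d.-homog -> \sum_i evaluate v z F i = 0).
Proof.
split=> [kz F hF|].
  elim/dhomog_ind: F / hF z kz =>
    {d} [d z _|d c F G hF hG z kz|z kz|d i F hF z kz].
  - by apply: big1 => i _; rewrite evaluate0.
  - rewrite (eq_bigr _ (fun i _ => evaluate_linear _ _ _ _ _ _)) big_split /=.
    by rewrite -big_distrr /= hF // hG // mulr0 addr0.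
  - rewrite -[RHS]kz; apply: eq_bigr => i _; rewrite /evaluate at_row1 mulr1.
    rewrite /along big1 ?addr0 // => j _.
    by rewrite -[1]/(1%:MP) mderivC /at_row meval0 mulr0.
  - rewrite X_lform (eq_bigr _ (fun j _ => evaluate_lform _ _ _ _ _)).
    exact: hF (kz _).
elim: d z => [|d IH] z h /=.
  rewrite -[RHS](h 1 (dhomog1 _ _)); apply: eq_bigr => i _.
  rewrite /evaluate at_row1 mulr1 /along big1 ?addr0 // => j _.
  by rewrite -[1]/(1%:MP) mderivC /at_row meval0 mulr0.
move=> l; apply: IH => G hG.
rewrite -(eq_bigr _ (fun j _ => evaluate_lform _ _ _ _ _)); apply: h.
rewrite -add1n; apply: dhomogM hG; exact: homog_lform.
Qed.

End Polynomials.

(** * Squares of ideals of points *)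

Section IdealSquares.

Variables (k : fieldType) (n : nat).

Notation poly := {mpoly k[n.+1]}.
Implicit Types (F G H : poly) (I : poly -> Prop) (p q : projspace k n).
Implicit Types (A S : {fset projspace k n}) (u : 'rV[k]_n.+1).

Lemma ideal_square0 I : ideal_square I 0.
Proof.
by exists 0%N, (fun=> 0), (fun=> 0); split; [case|rewrite big_ord0].
Qed.

Lemma ideal_squareM1 I F G : I F -> I G -> ideal_square I (F * G).
Proof. by exists 1%N, (fun=> F), (fun=> G); rewrite big_ord1. Qed.

Lemma ideal_squareD I F G :
  ideal_square I F -> ideal_square I G -> ideal_square I (F + G).
Proof.
move=> [r [a [b [ab ->]]]] [s [c [d [cd ->]]]].
exists (r + s)%N, (fun j => match split j with inl i => a i | inr i => c i end).
exists (fun j => match split j with inl i => b i | inr i => d i end); split.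
  by move=> j; case: (split j).
rewrite big_split_ord; congr (_ + _); apply: eq_bigr => i _.
  by rewrite -[lshift s i]/(unsplit (inl i)) unsplitK.
by rewrite -[rshift r i]/(unsplit (inr i)) unsplitK.
Qed.

Lemma ideal_square_sum I (J : Type) (r : seq J) (P : pred J) (F : J -> poly) :
  (forall j, P j -> ideal_square I (F j)) ->
  ideal_square I (\sum_(j <- r | P j) F j).
Proof.
move=> h; elim/big_rec: _ => [|j F' /h]; first exact: ideal_square0.
exact: ideal_squareD.
Qed.

Lemma ideal_square_mul I I' I'' F G :
  (forall F G, I F -> I' G -> I'' (F * G)) ->
  ideal_square I F -> ideal_square I' G -> ideal_square I'' (F * G).
Proof.
move=> h [r [a [b [ab ->]]]] [s [c [d [cd ->]]]].
rewrite big_distrl; apply: ideal_square_sum => j _.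
rewrite big_distrr; apply: ideal_square_sum => i _ /=.
by rewrite mulrACA; apply: ideal_squareM1; apply: h; case: (ab j); case: (cd i).
Qed.

Lemma double_pointsM S F G : double_points S F -> double_points S (G * F).
Proof.
move=> [r [a [b [ab ->]]]]; rewrite big_distrr.
apply: ideal_square_sum => j _ /=; rewrite mulrA.
apply: ideal_squareM1; last by case: (ab j).
by move=> p pS v vp; rewrite mevalM (proj1 (ab j) p pS v vp) mulr0.
Qed.

Lemma double_pointsU A S F G : double_points A F -> double_points S G ->
  double_points (A `|` S)%fset (F * G).
Proof.
apply: ideal_square_mul => {}F {}G hF hG p; rewrite in_fsetU => /orP[] h v vp.
  by rewrite mevalM (hF p h v vp) mul0r.
by rewrite mevalM (hG p h v vp) mulr0.
Qed.

Lemma double_pointsS A S F : {subset A <= S} -> double_points S F ->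
  double_points A F.
Proof.
move=> AS [r [a [b [ab ->]]]]; exists r, a, b; split=> // j.
by split=> p /AS; case: (ab j) => ha hb; [exact: ha|exact: hb].
Qed.

(** A coordinate which does not vanish at p; representatives are normalized to
    have it equal to 1. *)
Definition pivot p : 'I_n.+1 :=
  odflt ord0 [pick j | vpick (val p) 0 j != 0].

Definition rep p : 'rV[k]_n.+1 :=
  (vpick (val p) 0 (pivot p))^-1 *: vpick (val p).

Lemma vpick_pivot p : vpick (val p) 0 (pivot p) != 0.
Proof.
rewrite /pivot; case: pickP => //= h.
suff /eqP : vpick (val p) = 0.
  by rewrite vpick0 => /eqP p0; move: (valP p); rewrite p0 dimv0.
by apply/rowP => j; rewrite mxE; apply/eqP; move: (h j) => /negbFE.
Qed.

Lemma rep_pivot p : rep p 0 (pivot p) = 1.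
Proof. by rewrite mxE mulVf ?vpick_pivot. Qed.

Lemma rep_neq0 p : rep p != 0.
Proof.
by apply: contra_neq (oner_neq0 k) => h; rewrite -(rep_pivot p) h mxE.
Qed.

Lemma rep_line p : val p = <[rep p]>%VS.
Proof.
apply/esym/eqP; rewrite eqEdim -memvE dim_vline rep_neq0 (eqP (valP p)) leqnn.
by rewrite andbT memvZ // memv_pick.
Qed.

Lemma rep_inj p q : (rep p <= rep q)%MS -> p = q.
Proof.
move/sub_rVP => [c h]; apply: val_inj; apply/eqP.
rewrite eqEdim (eqP (valP p)) (eqP (valP q)) leqnn andbT.
by rewrite [val p]rep_line -memvE h memvZ // [val q]rep_line memv_line.
Qed.

Lemma van_lform S l : (forall p, p \in S -> lval l (rep p) = 0) ->
  van_ideal S (lform l).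
Proof.
move=> h p pS v; rewrite rep_line => /vlineP[c ->].
by rewrite -[LHS]/(at_row _ _) at_row_lform lvalZ h // mulr0.
Qed.

(** F vanishes at u to order at least 2. *)
Definition sing u F : Prop :=
  at_row F u = 0 /\ forall i, at_row F^`M(i) u = 0.

Lemma sing_along u F w : sing u F -> along w F u = 0.
Proof. by case=> _ h; rewrite /along big1 // => i _; rewrite h mulr0. Qed.

Lemma sing0 u : sing u 0.
Proof. by split=> [|i]; rewrite ?mderiv0 /at_row meval0. Qed.

Lemma singD u F G : sing u F -> sing u G -> sing u (F + G).
Proof.
move=> [F0 F1] [G0 G1].
by split=> [|i]; rewrite ?mderivD at_rowD ?F0 ?F1 ?G0 ?G1 addr0.
Qed.

Lemma singM u F G : sing u F -> sing u (G * F).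
Proof.
move=> [F0 F1]; split=> [|i]; first by rewrite at_rowM F0 mulr0.
by rewrite mderivM at_rowD !at_rowM F0 F1 !mulr0 addr0.
Qed.

Lemma sing_mul u F G : at_row F u = 0 -> at_row G u = 0 -> sing u (F * G).
Proof.
move=> F0 G0; split=> [|i]; first by rewrite at_rowM F0 mul0r.
by rewrite mderivM at_rowD !at_rowM F0 G0 mulr0 mul0r addr0.
Qed.

Lemma sing_cancel u F G : at_row G u != 0 -> sing u (G * F) -> sing u F.
Proof.
move=> Gu [h0 h1]; have F0 : at_row F u = 0.
  by move/eqP: h0; rewrite at_rowM mulf_eq0 (negbTE Gu) => /eqP.
split=> // i; move/eqP: (h1 i).
by rewrite mderivM at_rowD !at_rowM F0 mulr0 add0r mulf_eq0 (negbTE Gu) => /eqP.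
Qed.

Lemma double_points_sing S F p : double_points S F -> p \in S -> sing (rep p) F.
Proof.
move=> [r [a [b [ab ->]]]] pS.
elim/big_ind: _ => [|x y|j _]; first exact: sing0.
  exact: singD.
have rp : rep p \in val p by rewrite [val p]rep_line memv_line.
by apply: sing_mul; case: (ab j) => ha hb; [apply: ha rp|apply: hb rp].
Qed.

Lemma lval_delta i u : lval (delta_mx i 0) u = u 0 i.
Proof. by rewrite /lval -colE mxE. Qed.

(** Substituting X_i = y_i + r_i X_j, where r represents p, j is the pivot and
    y_i vanishes at p, expands F to first order in the y_i. *)
Lemma homog_taylor p d F : F \is d.+1.-homog ->
  exists (a : k) (l : 'cV[k]_n.+1), lval l (rep p) = 0 /\
    double_points [fset p]%fset
      (F - (a *: 'X_(pivot p) ^+ d.+1 + lform l * 'X_(pivot p) ^+ d)).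
Proof.
set j := pivot p; set J := double_points _.
pose P e F := match e with 0 => exists a, F = a%:MP | e'.+1 =>
  exists (a : k) (l : 'cV[k]_n.+1), lval l (rep p) = 0 /\
    J (F - (a *: 'X_j ^+ e'.+1 + lform l * 'X_j ^+ e')) end.
have J0 : J 0 by exact: ideal_square0.
have lformD c l l' : lform (c *: l + l') = c *: lform l + lform l' :> poly.
  rewrite /lform scaler_sumr -big_split; apply: eq_bigr => i _ /=.
  by rewrite !mxE scalerDl scalerA.
have lform0 : lform 0 = 0 :> poly.
  by rewrite /lform big1 // => i _; rewrite mxE scale0r.
have lvalP c l l' u : lval (c *: l + l') u = c * lval l u + lval l' u.
  by rewrite /lval mulmxDr -scalemxAr !mxE.
have lval0l u : lval 0 u = 0 by rewrite /lval mulmx0 mxE.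
have Jscale c G : J G -> J (c *: G).
  by rewrite -mul_mpolyC; exact: double_pointsM.
pose y i : 'cV[k]_n.+1 := (- rep p 0 i) *: delta_mx j 0 + delta_mx i 0.
have yp i : lval (y i) (rep p) = 0.
  by rewrite /y lvalP !lval_delta rep_pivot mulr1 addNr.
have XE i : 'X_i = lform (y i) + rep p 0 i *: 'X_j :> poly.
  by rewrite /y lformD -!X_lform scaleNr addrAC addNr add0r.
have van l : lval l (rep p) = 0 -> van_ideal [fset p]%fset (lform l).
  by move=> h; apply: van_lform => q; move=> /fset1P->.
move=> hF; suff : P d.+1 F by [].
move: hF; apply: dhomog_ind => {d F}.
- case=> [|d]; first by exists 0; rewrite mpolyC0.
  by exists 0, 0; rewrite lval0l lform0 scale0r mul0r addr0 subr0.
- case=> [|d] c F G; first by move=> [a ->] [b ->]; exists (c * a + b);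
    rewrite mpolyCD mpolyCM mul_mpolyC.
  move=> [a [l [lp JF]]] [b [m [mp JG]]]; exists (c * a + b), (c *: l + m).
  rewrite lvalP lp mp mulr0 addr0; split=> //.
  rewrite lformD scalerDl mulrDl -scalerA -scalerAl addrACA -scalerDr.
  rewrite opprD addrACA -scalerBr; apply: ideal_squareD JG; exact: Jscale.
- by exists 1.
- case=> [|d] i F.
    move=> [a ->]; exists (a * rep p 0 i), (a *: y i + 0).
    split; first by rewrite lvalP lval0l yp mulr0 addr0.
    suff -> : 'X_i * a%:MP - ((a * rep p 0 i) *: 'X_j ^+ 1 +
      lform (a *: y i + 0) * 'X_j ^+ 0) = 0 :> poly by [].
    rewrite lformD lform0 XE -!mul_mpolyC mpolyCM expr1 expr0; ring.
  move=> [a [l [lp JF]]].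
  exists (a * rep p 0 i), (rep p 0 i *: l + (a *: y i + 0)).
  split; first by rewrite lvalP lvalP lval0l yp lp !mulr0 !addr0.
  have -> : 'X_i * F - ((a * rep p 0 i) *: 'X_j ^+ d.+2 +
      lform (rep p 0 i *: l + (a *: y i + 0)) * 'X_j ^+ d.+1) =
      'X_i * (F - (a *: 'X_j ^+ d.+1 + lform l * 'X_j ^+ d)) +
      'X_j ^+ d * (lform (y i) * lform l) :> poly.
    rewrite lformD lformD lform0 XE -!mul_mpolyC mpolyCM !exprS; ring.
  apply: ideal_squareD; first exact: double_pointsM.
  by apply/double_pointsM/ideal_squareM1; exact: van.
Qed.

(** In the expansion of [homog_taylor] the value at p is a, and the derivatives
    in the directions other than the pivot are the coefficients of a linear
    form which vanishes at p; so all of a and l is zero. *)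
Lemma homog_double_point p d F : F \is d.+1.-homog ->
  at_row F (rep p) = 0 ->
  (forall i, i != pivot p -> at_row F^`M(i) (rep p) = 0) ->
  double_points [fset p]%fset F.
Proof.
move=> hF F0 F1; have [a [l [lp JF]]] := homog_taylor p hF.
set X := 'X_(pivot p) in JF; set R := F - _ in JF.
have [R0 R1] := double_points_sing JF (fset11 p).
have X1 m : at_row (X ^+ m) (rep p) = 1.
  by rewrite at_rowE /X at_rowX rep_pivot expr1n.
have a0 : a = 0.
  move: R0; rewrite /R at_rowD at_rowN at_rowD at_rowZ at_rowM at_row_lform.
  by rewrite F0 lp X1 mulr1 mul0r addr0 add0r => /eqP; rewrite oppr_eq0 => /eqP.
have l0 i : i != pivot p -> l i 0 = 0.
  move=> ip; move: (R1 i); rewrite /R a0 scale0r add0r mderivB at_rowD at_rowN.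
  rewrite F1 // mderivM at_rowD !at_rowM at_row_lform lp mul0r addr0 X1 mulr1.
  rewrite add0r mderiv_lform /at_row mevalC => /eqP.
  by rewrite oppr_eq0 => /eqP.
have lj : l (pivot p) 0 = 0.
  move: lp; rewrite -at_row_lform /lform (bigD1 (pivot p)) //= big1; last first.
    by move=> i /l0->; rewrite scale0r.
  by rewrite addr0 at_rowZ at_rowX rep_pivot mulr1.
have ll : lform l = 0.
  rewrite /lform big1 // => i _; have [->|/l0->] := eqVneq i (pivot p).
    by rewrite lj scale0r.
  by rewrite scale0r.
by move: JF; rewrite /R a0 ll scale0r mul0r addr0 subr0.
Qed.

Lemma separating_forms p q i : p != q ->
  exists a b : 'cV[k]_n.+1,
  [/\ lval a (rep p) = 0, lval b (rep q) = 0 &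
      'X_i = lform a + lform b :> poly].
Proof.
move=> pq; have [|l [lp lq]] := @separate _ _ _ (rep p) (rep q).
  by apply: contra pq => /rep_inj->.
pose c := rep q 0 i / lval l (rep q).
have lvalP x m m' u : lval (x *: m + m') u = x * lval m u + lval m' u.
  by rewrite /lval mulmxDr -scalemxAr !mxE.
exists (c *: l), ((- c) *: l + delta_mx i 0); split.
- by rewrite /lval -scalemxAr lp scaler0 mxE.
- by rewrite lvalP lval_delta mulNr divfK ?addNr.
rewrite X_lform /lform -big_split; apply: eq_bigr => j _ /=.
by rewrite -scalerDl !mxE mulNr addrA subrr add0r.
Qed.

(** With X_i = a + b for linear forms a, b vanishing at p, q respectively, the
    cube (a + b)^3 = a^2 (a + 3b) + b^2 (3a + b) splits into a part in the
    square of the ideal of p and a part in that of q; the parts for the various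
    q in A multiply. *)
Lemma comaximal A p i : p \notin A ->
  exists E, [/\ E \is (3 * #|` A|).-homog, double_points A E &
                double_points [fset p]%fset ('X_i ^+ (3 * #|` A|) - E)].
Proof.
elim/fset1U_rect: A => [|q A qA IH].
  move=> _; exists 1; rewrite cardfs0 muln0 expr0 subrr; split.
  - exact: dhomog1.
  - by rewrite -[1]mulr1; apply: ideal_squareM1 => r; rewrite in_fset0.
  - exact: ideal_square0.
rewrite in_fset1U negb_or => /andP[pq pA]; have [E [hE AE pE]] := IH pA.
have [a [b [ap bq XE]]] := separating_forms i pq.
pose M : poly := lform b ^+ 2 * (3%:R *: lform a + lform b).
pose M' : poly := lform a ^+ 2 * (lform a + 3%:R *: lform b).
have qM : double_points [fset q]%fset M.
  rewrite /M mulrC; apply/double_pointsM/ideal_squareM1; 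
  by apply: van_lform => ? /fset1P->.
have pM' : double_points [fset p]%fset M'.
  rewrite /M' mulrC; apply/double_pointsM/ideal_squareM1; 
  by apply: van_lform => ? /fset1P->.
have X3 : 'X_i ^+ 3 = M + M' :> poly.
  by rewrite /M /M' XE -!mul_mpolyC; ring.
exists (M * E); rewrite cardfsU1 qA mulnDr muln1; split.
- apply: dhomogM hE; apply: (@dhomogM _ _ _ 2 _ 1).
    by rewrite -[2%N]/(1 * 2)%N; apply: dhomogMn; exact: homog_lform.
  by apply: dhomogD; [apply: dhomogZ|]; exact: homog_lform.
- exact: double_pointsU.
rewrite exprD X3.
rewrite mulrDl addrAC -mulrBr.
by apply: ideal_squareD; [|rewrite mulrC]; apply: double_pointsM.
Qed.

(** The symbolic square and the square of the ideal of A agree after inverting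
    X_i: one point is added at a time, splitting a power of X_i by
    [comaximal]. *)
Lemma saturation A i F :
  (forall p, p \in A -> double_points [fset p]%fset F) ->
  exists N, double_points A ('X_i ^+ N * F).
Proof.
elim/fset1U_rect: A => [|p A pA IH] h.
  exists 0%N; rewrite mul1r -[F]mul1r.
  by apply: ideal_squareM1 => r; rewrite in_fset0.
have [|N hN] := IH; first by move=> q qA; apply: h; rewrite in_fset1U qA orbT.
have [E [_ AE pE]] := comaximal i pA.
have pF : double_points [fset p]%fset F by apply: h; rewrite in_fset1U eqxx.
exists (3 * #|` A| + N)%N.
have -> : 'X_i ^+ (3 * #|` A| + N) * F =
  ('X_i ^+ (3 * #|` A|) - E) * ('X_i ^+ N * F) + 'X_i ^+ N * (F * E).
  by rewrite exprD -mulrA mulrBl [F * E]mulrC (mulrCA ('X_i ^+ N)) subrK.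
apply: ideal_squareD; first exact: double_pointsU.
exact/double_pointsM/double_pointsU.
Qed.

End IdealSquares.

(** * Relations versus prescribed jets *)

Section Duality.

Variables (k : fieldType) (n : nat).

Notation poly := {mpoly k[n.+1]}.

(** Finitely many functionals on forms of degree d are dependent or jointly
    onto: rows of their matrix on monomials. *)
Lemma functional_duality (R : finType) (phi : R -> poly -> k) d :
  (forall r c F G, phi r (c *: F + G) = c * phi r F + phi r G) ->
  (exists y : R -> k, (exists r, y r != 0) /\
     forall F, F \is d.-homog -> \sum_r y r * phi r F = 0) \/
  (forall t : R -> k, exists F, F \is d.-homog /\ forall r, phi r F = t r).
Proof.
move=> lin; have phi0 r : phi r 0 = 0.
  by have := lin r (-1) 0 0; rewrite scaler0 addr0 mulN1r addNr.
have phi_sum r (J : Type) (s : seq J) (P : pred J) c (F : J -> poly) :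
    phi r (\sum_(j <- s | P j) c j *: F j) =
    \sum_(j <- s | P j) c j * phi r (F j).
  by elim/big_rec2: _ => [|j x y _ <-]; [exact: phi0|exact: lin].
pose B : finType := 'X_{1..n.+1 < d.+1}.
pose mono (b : 'X_{1..n.+1 < d.+1}) : poly := if mdeg b == d then 'X_[b] else 0.
pose M := \matrix_(r < #|R|, b < #|B|) phi (enum_val r) (mono (enum_val b)).
have [/row_freeP[M' MM']|] := boolP (row_free M).
  right=> t; pose c := M' *m (\col_r t (enum_val r)).
  exists (\sum_(b < #|B|) c b 0 *: mono (enum_val b)); split.
    apply: rpred_sum => b _; apply: dhomogZ; rewrite /mono.
    by case: ifP => [|_]; [rewrite dhomogX|exact: dhomog0].
  move=> r; rewrite phi_sum.
  have : (M *m c) (enum_rank r) 0 = t r.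
    by rewrite /c mulmxA MM' mul1mx mxE enum_rankK.
  rewrite mxE => <-; apply: eq_bigr => b _.
  by rewrite [M _ _]mxE enum_rankK mulrC.
rewrite -kermx_eq0 => /rowV0Pn[y /sub_kermxP yM y0]; left.
exists (fun r => y 0 (enum_rank r)); split.
  apply/existsP; apply: contraR y0 => /existsPn h; apply/eqP/rowP => r.
  by move: (h (enum_val r)); rewrite enum_valK negbK mxE => /eqP.
move=> F hF; rewrite [F]mpolyE.
under eq_bigr => r _ do rewrite phi_sum mulr_sumr.
rewrite exchange_big big_seq; apply: big1 => m mF /=.
have md : mdeg m = d by exact: (dhomogP _ _ _ hF).
have mb : (mdeg m < d.+1)%N by rewrite md.
move/rowP: yM => /(_ (enum_rank (BMultinom mb : B))); rewrite !mxE => h.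
rewrite -[RHS](mulr0 F@_m) -[X in _ = _ * X]h mulr_sumr.
rewrite [RHS](reindex_onto (@enum_rank R) enum_val) /=; last first.
  by move=> r _; rewrite enum_valK.
apply: eq_big => r; first by rewrite enum_rankK eqxx.
by move=> _; rewrite mxE !enum_rankK /mono /= md eqxx mulrCA.
Qed.

(** At v_i with j-th coordinate 1, the value and the derivatives other than the
    j-th are used: their combinations are the families with w_j = 0, and
    these are tangent because the j-th coordinate of w is zero and that of v_i
    is not. *)
Lemma jets_onto (I : finType) (v : I -> 'rV[k]_n.+1) (j : I -> 'I_n.+1) d :
  (forall i, v i 0 (j i) = 1) ->
  (forall z, tangent v z -> kills v d z -> forall i, z i = 0) ->
  forall T : I -> poly, exists F, F \is d.-homog /\ forall i,
    at_row F (v i) = at_row (T i) (v i) /\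
    forall c, c != j i -> at_row F^`M(c) (v i) = at_row (T i)^`M(c) (v i).
Proof.
move=> v1 none T.
pose phi (r : I * 'I_n.+1) (F : poly) := 
  at_row (if r.2 == j r.1 then F else F^`M(r.2)) (v r.1).
have lin r c F G : phi r (c *: F + G) = c * phi r F + phi r G.
  rewrite /phi; case: ifP => _; rewrite ?mderivD ?mderivZ;
  by rewrite at_rowD at_rowZ.
case: (functional_duality d lin) => [[y [[[i0 c0] /= y0] hy]]|onto].
  pose z : functional k n.+1 I := fun i =>
    (y (i, j i), \row_c (if c == j i then 0 else y (i, c))).
  have zi0 : z i0 = 0.
    apply: none.
  + move=> i nz; apply: contra nz => /sub_rVP[c zi].
    have : (z i).2 0 (j i) = 0 by rewrite mxE eqxx.
    by rewrite zi mxE v1 mulr1 => ->; rewrite scale0r.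
  + apply/kills_evaluate => F hF; rewrite -[RHS](hy F hF).
    rewrite (eq_bigr (fun i => \sum_c y (i, c) * phi (i, c) F)).
      by rewrite pair_big; apply: eq_bigr => -[].
    move=> i _; rewrite /evaluate /along [RHS](bigD1 (j i)) //= /phi /= eqxx.
    congr (_ + _); rewrite (bigD1 (j i)) //= mxE eqxx mul0r add0r.
    by apply: eq_bigr => c cj; rewrite mxE (negbTE cj).
  move: y0; have [->|cj] := eqVneq c0 (j i0).
    by move: (congr1 fst zi0) => /= ->; rewrite eqxx.
  move: (congr1 (fun x : k * 'rV[k]_n.+1 => x.2 0 c0) zi0).
  rewrite /= !mxE (negbTE cj) => ->.
  by rewrite eqxx.
have [F [hF h]] := onto (fun r => phi r (T r.1)); exists F; split=> // i; split.
  by have := h (i, j i); rewrite /phi /= eqxx.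
by move=> c cj; have := h (i, c); rewrite /phi /= (negbTE cj).
Qed.

End Duality.

(** * Cech cohomology of twists of the structure sheaf *)

Section FractionIdentities.

Variable K : fieldType.
Implicit Types (a b c f g q u w x y : K).

Lemma cocycle_clear_denominators c c' x y z w h : (c - c') * w = h ->
  c * (x * z) * y * w - c' * (x * y) * z * w = x * (h * y * z).
Proof. by move=> <-; ring. Qed.

Lemma split_fraction c x y q u : x != 0 -> y != 0 ->
  c * (x * y) = x * q + y * u -> c = q / y - (- u) / x.
Proof.
move=> x0 y0 h; apply: (mulIf (mulf_neq0 x0 y0)); rewrite h.
by field; rewrite x0 y0.
Qed.

Lemma cross_multiply c x y f g h w : x != 0 -> y != 0 -> w != 0 ->
  c = f / x - g / y -> c = h / w -> y * x * h = w * (f * y - g * x).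
Proof.
move=> x0 y0 w0 cfg ch; have -> : h = c * w by rewrite ch divfK.
by rewrite cfg; field; rewrite x0 y0.
Qed.

Lemma common_denominator f g x y w : x != 0 -> y != 0 -> w != 0 ->
  g / x - f = y * (w * (g - f * x)) / (y * (w * x)).
Proof. by move=> x0 y0 w0; field; rewrite x0 y0 w0. Qed.

Lemma difference_fraction f g c x y u w :
  x != 0 -> y != 0 -> u != 0 -> w != 0 ->
  c * f / y - c * g / x = w * (u * (c * (f * x - g * y))) / (x * u * (y * w)).
Proof. by move=> x0 y0 u0 w0; field; rewrite x0 y0 u0 w0. Qed.

Lemma subtract_fraction f g x y : x != 0 -> y != 0 ->
  (f * y - g * x) / (x * y) = f / x - g / y.
Proof. by move=> x0 y0; field; rewrite x0 y0. Qed.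

Lemma exchange_difference f g x y : f - g = x - y -> g - y = f - x.
Proof. by move=> h; have -> : f = x - y + g by [rewrite -h subrK]; ring. Qed.

End FractionIdentities.

Section Cech.

Variables (k : fieldType) (n : nat).

Notation poly := {mpoly k[n.+1]}.
Notation frac := (@FracField.tofrac poly).
Implicit Types (F G H Q R : poly) (i j l : 'I_n.+1).

Lemma mpolyXpow i m : 'X_i ^+ m = 'X_[U_(i) *+ m] :> poly.
Proof. exact: mpolyXn. Qed.

Lemma X_neq0 i m : 'X_i ^+ m != 0 :> poly.
Proof. by rewrite mpolyXpow -msupp_eq0 msuppX. Qed.

(** R is a remainder in the division by X_i^m. *)
Definition low i m R := forall u : 'X_{1..n.+1}, u \in msupp R -> (u i < m)%N.

Lemma split_power i m D F : F \is D.-homog ->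
  exists Q R, [/\ F = 'X_i ^+ m * Q + R, Q \is (D - m)%N.-homog,
                  R \is D.-homog & low i m R].
Proof.
move=> hF.
exists (\sum_(u <- msupp F | (m <= u i)%N) F@_u *: 'X_[u - U_(i) *+ m]).
exists (\sum_(u <- msupp F | ~~ (m <= u i)%N) F@_u *: 'X_[u]); split.
- rewrite {1}[F]mpolyE (bigID (fun u : 'X_{1..n.+1} => m <= u i)%N) /=.
  congr (_ + _); rewrite mulr_sumr; apply: eq_bigr => u mu.
  rewrite -scalerAr mpolyXpow -mpolyXD addmC submK //.
  apply/mnm_lepP => j; rewrite mulmnE mnm1E.
  by case: eqP => [<-|_]; rewrite ?mul1n ?mul0n.
- rewrite big_seq_cond; apply: rpred_sum => u /andP[uF mu].
  have hD : mdeg u = D by exact: (dhomogP _ _ _ hF _ uF).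
  apply: dhomogZ; rewrite dhomogX; apply/eqP.
  have le : (U_(i) *+ m <= u)%MM.
    apply/mnm_lepP => j; rewrite mulmnE mnm1E.
    by case: eqP => [<-|_]; rewrite ?mul1n ?mul0n.
  have e : mdeg u = (mdeg (u - U_(i) *+ m)%MM + m)%N.
    by rewrite -{1}(submK le) mdegD mdegMn mdeg1 mul1n.
  by rewrite -hD e addnK.
- rewrite big_seq_cond; apply: rpred_sum => u /andP[uF mu].
  by apply: dhomogZ; rewrite dhomogX; apply/eqP; exact: (dhomogP _ _ _ hF _ uF).
move=> u; rewrite mcoeff_msupp raddf_sum /=; apply: contraR.
rewrite -leqNgt => mu; apply/eqP; apply: big1 => w mw.
rewrite mcoeffZ mcoeffX; case: eqP => [wu|_]; last by rewrite mulr0.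
by rewrite wu mu in mw.
Qed.

Lemma low_eq0 i m R G : low i m R -> R = 'X_i ^+ m * G -> R = 0.
Proof.
move=> lR RG; have [G0|G0] := eqVneq G 0; first by rewrite RG G0 mulr0.
have [u uG] : exists u, u \in msupp G.
  case E : (msupp G) => [|u s]; last by exists u; rewrite inE eqxx.
  by move/eqP: E; rewrite msupp_eq0 (negbTE G0).
have : (U_(i) *+ m + u)%MM \in msupp R.
  by rewrite RG mulrC mpolyXpow mcoeff_msupp mcoeffMX -mcoeff_msupp.
by move/lR; rewrite mnmDE mulmnE mnm1E eqxx mul1n ltnNge leq_addr.
Qed.

Lemma lowB i m R R' : low i m R -> low i m R' -> low i m (R - R').
Proof.
by move=> h h' u /msuppB_le; rewrite mem_cat => /orP[/h|/h'].
Qed.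

Lemma lowMX i j m e R : i != j -> low i m R -> low i m (R * 'X_j ^+ e).
Proof.
move=> ij h u; rewrite mpolyXpow (perm_mem (msuppMX _ _)) => /mapP[w /h wm ->].
by rewrite mnmDE mulmnE mnm1E eq_sym (negbTE ij) mul0n.
Qed.

Lemma divX i j m e D F G : i != j -> F \is D.-homog ->
  F * 'X_j ^+ e = 'X_i ^+ m * G ->
  exists Q, Q \is (D - m)%N.-homog /\ F = 'X_i ^+ m * Q.
Proof.
move=> ij hF FG; have [Q [R [FE hQ _ lR]]] := split_power i m hF.
exists Q; split=> //; suff R0 : R = 0 by rewrite FE R0 addr0.
have : R * 'X_j ^+ e = 0.
  apply: (@low_eq0 i m _ (G - Q * 'X_j ^+ e)); first exact: lowMX.
  by rewrite mulrBr -FG FE mulrDl mulrA addrAC subrr add0r.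
by move/eqP; rewrite mulf_eq0 (negbTE (X_neq0 _ _)) orbF => /eqP.
Qed.

Lemma frac_neq0 F : F != 0 -> frac F != 0.
Proof. by rewrite tofrac_eq0. Qed.

Lemma fracX_neq0 i m : frac ('X_i ^+ m) != 0.
Proof. exact/frac_neq0/X_neq0. Qed.

Lemma frac_inj : injective frac.
Proof. by move=> F G /eqP; rewrite tofrac_eq => /eqP. Qed.

Lemma fracM F G : frac (F * G) = frac F * frac G.
Proof. exact: tofracM. Qed.

Lemma fracM3 F G H : frac (F * G * H) = frac F * frac G * frac H.
Proof. by rewrite !fracM. Qed.

Variables (J : poly -> Prop) (d : nat).
Hypothesis JM : forall F G, J F -> J (G * F).

Lemma section1P i f : section_over J d [set i] f <->
  exists m F, [/\ J F, F \is (d + m)%N.-homog & f = frac F / frac ('X_i ^+ m)].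
Proof.
by split=> -[m [F]]; rewrite ?cards1 ?big_set1 ?muln1 => h; exists m, F;
  rewrite ?cards1 ?big_set1 ?muln1.
Qed.

Lemma section2P i j f : i != j -> section_over J d [set i; j] f <->
  exists m F, [/\ J F, F \is (d + m * 2)%N.-homog &
                  f = frac F / frac (('X_i * 'X_j) ^+ m)].
Proof.
move=> ij; have ni : i \notin [set j] by rewrite inE.
by split=> -[m [F]]; rewrite ?big_setU1 ?big_set1 ?cards2 ?ij //= => h;
  exists m, F; rewrite ?big_setU1 ?big_set1 ?cards2 ?ij.
Qed.

Lemma section2_raise i j f : i != j -> section_over J d [set i; j] f ->
  exists m, forall M, (m <= M)%N -> exists F,
    [/\ J F, F \is (d + M * 2)%N.-homog &
        f = frac F / frac (('X_i * 'X_j) ^+ M)].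
Proof.
move=> ij /section2P[] // m [F [JF hF ->]]; exists m => M mM.
exists (('X_i * 'X_j) ^+ (M - m) * F); split; first exact: JM.
  have -> : (d + M * 2 = 2 * (M - m) + (d + m * 2))%N by lia.
  apply: dhomogM hF; apply: dhomogMn; rewrite -[2%N]/(1 + 1)%N.
  by apply: dhomogM; exact: homogX.
have -> : ('X_i * 'X_j) ^+ M =
    ('X_i * 'X_j) ^+ (M - m) * ('X_i * 'X_j) ^+ m :> poly.
  by rewrite -exprD subnK.
rewrite !tofracM -mulf_div divff ?mul1r //.
by rewrite frac_neq0 // exprMn mulf_neq0 ?X_neq0.
Qed.

(** A section of O(d) over two of the standard open sets is a form, since
    powers of distinct variables are coprime. *)
Lemma cech_H0 i j m e F G : i != j -> F \is (d + m)%N.-homog ->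
  frac F / frac ('X_i ^+ m) = frac G / frac ('X_j ^+ e) ->
  exists Q, Q \is d.-homog /\ frac F / frac ('X_i ^+ m) = frac Q.
Proof.
move=> ij hF /eqP; rewrite eqr_div ?fracX_neq0 // -!tofracM => /eqP/frac_inj FG.
have [|Q [hQ FQ]] := @divX i j m e _ F G ij hF; first by rewrite FG mulrC.
rewrite FQ.
exists Q; rewrite addnK in hQ; split=> //.
by rewrite tofracM mulrAC divff ?mul1r ?fracX_neq0.
Qed.

(** H^1(P^n, O(d)) = 0 for n >= 2.  Each c_0j is split into the part without
    poles along X_0 and the part R_j with poles along X_0.  As c_jl has no pole
    along X_0, these polar parts coincide; their common value has no pole along
    any X_j with j <> 0, because R_l has none for l different from 0 and j. *)
Lemma cech_H1 (c : 'I_n.+1 -> 'I_n.+1 -> {fraction poly}) :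
  (2 <= n)%N -> cocycle1 J d c ->
  exists m (G : 'I_n.+1 -> poly), (forall i, G i \is (d + m)%N.-homog) /\
    forall i j, c i j = frac (G j) / frac ('X_j ^+ m)
                      - frac (G i) / frac ('X_i ^+ m).
Proof.
move=> n2 [sec coc]; pose z : 'I_n.+1 := ord0.
have cii i : c i i = 0 by have := coc i i i; rewrite subrr add0r.
have cE i j : c i j = c z j - c z i.
  have /eqP := coc z i j; rewrite addrAC subr_eq0 => /eqP <-.
  by rewrite addrK.
have hmf j : exists e, j != z -> forall M, (e <= M)%N -> exists F,
    [/\ J F, F \is (d + M * 2)%N.-homog &
        c z j = frac F / frac (('X_z * 'X_j) ^+ M)].
  have [->|jz] := eqVneq j z; first by exists 0.
  have zj : z != j by rewrite eq_sym.
  by have [e he] := section2_raise zj (sec z j); exists e.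
have {hmf} [mf hmf] := fin_all_exists hmf.
pose m := (\max_j mf j)%N.
have {hmf} hc j : j != z -> exists F, [/\ J F, F \is (d + m * 2)%N.-homog &
        c z j = frac F / frac (('X_z * 'X_j) ^+ m)].
  by move=> jz; apply: hmf => //; exact: leq_bigmax.
have hQR j : exists QR : poly * poly, j != z ->
   [/\ QR.1 \is (d + m)%N.-homog, QR.2 \is (d + m * 2)%N.-homog,
     low z m QR.2 & c z j * (frac ('X_z ^+ m) * frac ('X_j ^+ m)) =
        frac ('X_z ^+ m * QR.1 + QR.2)].
  have [->|jz] := eqVneq j z; first by exists 0.
  have [F [_ hF cF]] := hc j jz.
  have [Q [R [FE hQ hR lR]]] := split_power z m hF.
  exists (Q, R) => _; split=> //=.
    by move: hQ; have -> : (d + m * 2 - m = d + m)%N by lia.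
  rewrite cF -FE -fracM -exprMn divfK //.
  by rewrite frac_neq0 // exprMn mulf_neq0 ?X_neq0.
have {hQR} [QR hQR] := fin_all_exists hQR.
pose Q j := (QR j).1; pose R j := (QR j).2.
have RC j l : j != z -> l != z -> j != l -> R l * 'X_j ^+ m = R j * 'X_l ^+ m.
  move=> jz lz jl; have [_ _ lj cj] := hQR j jz; have [_ _ ll cl] := hQR l lz.
  have [e [H [_ _ cjl]]] := proj1 (section2P _ jl) (sec j l).
  pose W := 'X_j ^+ e * 'X_l ^+ e : poly.
  have W0 : W != 0 by rewrite mulf_neq0 ?X_neq0.
  have cW : (c z l - c z j) * frac W = frac H.
    by rewrite -cE cjl exprMn divfK ?frac_neq0.
  have key : ('X_z ^+ m * Q l + R l) * 'X_j ^+ m * W -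
             ('X_z ^+ m * Q j + R j) * 'X_l ^+ m * W =
             'X_z ^+ m * (H * 'X_j ^+ m * 'X_l ^+ m).
    apply: frac_inj; rewrite tofracB !fracM3 -cl -cj fracM fracM3.
    exact: cocycle_clear_denominators.
  suff : (R l * 'X_j ^+ m - R j * 'X_l ^+ m) * W = 0.
    by move/eqP; rewrite mulf_eq0 (negbTE W0) orbF subr_eq0 => /eqP.
  apply: (@low_eq0 z m _ (H * 'X_j ^+ m * 'X_l ^+ m -
                         (Q l * 'X_j ^+ m - Q j * 'X_l ^+ m) * W)).
    rewrite /W mulrA; do 2 (apply: lowMX; first by rewrite eq_sym).
    by apply: lowB; apply: lowMX; rewrite // eq_sym.
  rewrite mulrBr -key.
  move: (R l) (R j) (Q l) (Q j) {W0 cW key}W.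
  move: ('X_z ^+ m) ('X_j ^+ m) ('X_l ^+ m).
  clear => *; ring.
pose j1 : 'I_n.+1 := inord 1; pose l1 : 'I_n.+1 := inord 2.
have j1z : j1 != z by rewrite -val_eqE /= inordK //; lia.
have l1z : l1 != z by rewrite -val_eqE /= inordK //; lia.
have jl1 : j1 != l1 by rewrite -val_eqE /= !inordK //; lia.
have [_ hR1 _ _] := hQR j1 j1z.
have [|U [hU RU]] := @divX j1 l1 m m _ _ (R l1) jl1 hR1.
  by rewrite -(RC j1 l1) // mulrC.
have e : (d + m * 2 - m = d + m)%N by lia.
rewrite e in hU; rewrite -/(R j1) in RU.
have RUj j : j != z -> R j = 'X_j ^+ m * U.
  move=> jz; have [->|jj1] := eqVneq j j1; first exact: RU.
  have j1j : j1 != j by rewrite eq_sym.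
  apply: (mulIf (X_neq0 j1 m)); rewrite (RC _ _ j1z jz j1j) RU.
  by rewrite [LHS]mulrC mulrA mulrAC.
pose G j := if j == z then - U else Q j.
exists m, G; split.
  move=> i; rewrite /G; case: eqVneq => [_|/hQR[]//]; by rewrite dhomogN.
have cz j : c z j = frac (G j) / frac ('X_j ^+ m)
                  - frac (G z) / frac ('X_z ^+ m).
  rewrite /G eqxx; have [->|jz] := eqVneq j z; first by rewrite cii subrr.
  have [_ _ _ cj] := hQR j jz.
  rewrite -/(R j) RUj // tofracD !fracM in cj.
  by rewrite tofracN; apply: split_fraction cj; exact: fracX_neq0.
by move=> i j; rewrite cE !cz opprB addrA subrK.
Qed.

End Cech.

(** * Cech cohomology of the ideal of double points *)

Section Bridges.

Variables (k : fieldType) (n : nat).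

Notation poly := {mpoly k[n.+1]}.
Notation frac := (@FracField.tofrac poly).
Implicit Types (F G H : poly) (i j : 'I_n.+1) (p q : projspace k n).
Implicit Types (A S : {fset projspace k n}).

Lemma mderivXn_neq i j m : i != j -> ('X_j ^+ m)^`M(i) = 0 :> poly.
Proof.
move=> ij; elim: m => [|m IH]; first by rewrite expr0 -[1]/(1%:MP) mderivC.
by rewrite exprS mderivM IH mderivXU (negbTE ij) mul0r mulr0 addr0.
Qed.

Lemma at_pivot p m : at_row ('X_(pivot p) ^+ m) (rep p) = 1.
Proof. by rewrite at_rowE at_rowX rep_pivot expr1n. Qed.

Lemma homog_sing p d F : F \is d.+1.-homog -> sing (rep p) F ->
  double_points [fset p]%fset F.
Proof. by move=> hF [F0 F1]; apply: homog_double_point hF F0 _ => i _. Qed.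

(** The local sections b_i = G_i / X_i^m of O(d) bounding a cocycle of the
    ideal sheaf of 2S agree to first order at S.  The form F is chosen with the
    jet at p of b_j, j being the pivot of p, and b_i - F then lies in the
    ideal. *)
Lemma jets_h1_eq0 S d : (2 <= n)%N ->
  (forall T : S -> poly, exists F, F \is d.+1.-homog /\ forall p : S,
    at_row F (rep (val p)) = at_row (T p) (rep (val p)) /\
    forall c, c != pivot (val p) ->
      at_row F^`M(c) (rep (val p)) = at_row (T p)^`M(c) (rep (val p))) ->
  h1_eq0 (double_points S) d.+1.
Proof.
move=> n2 onto c cc; have [sec _] := cc.
have [m [G [hG cG]]] := cech_H1 (@double_pointsM k n S) n2 cc.
have [F [hF jets]] := onto (fun p : S => G (pivot (val p))).
have hGF i : G i - F * 'X_i ^+ m \is (d.+1 + m).-homog.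
  by rewrite rpredB // dhomogM // homogXn.
have loc i p : p \in S ->
    double_points [fset p]%fset ('X_i ^+ 2 * (G i - F * 'X_i ^+ m)).
  move=> pS; apply: (@homog_sing p (2 + (d + m))).
    rewrite -addnS -addSn; by apply: dhomogM => //; exact: homogXn.
  (* Points outside U_i are dealt with by the factor X_i^2. *)
  have [xi|xi] := eqVneq (at_row 'X_i (rep p)) 0.
    by rewrite mulrC; apply: singM; exact: sing_mul.
  apply: singM; set j := pivot p.
  have [/= J0 J1] := jets [` pS]%fset.
  have sj : sing (rep p) (G j - F * 'X_j ^+ m).
    apply: double_points_sing (fset11 p); apply: homog_double_point (hGF j) _ _.
      by rewrite at_rowD at_rowN at_rowM at_pivot J0 mulr1 subrr.
    move=> i' i'j; rewrite mderivB mderivM mderivXn_neq // mulr0 addr0.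
    by rewrite at_rowD at_rowN at_rowM at_pivot J1 // mulr1 subrr.
  have [->//|ij] := eqVneq i j.
  have ji : j != i by rewrite eq_sym.
  have [e [H [JH _ cji]]] := proj1 (section2P _ _ _ ji) (sec j i).
  have key : ('X_j * 'X_i) ^+ m * H =
      ('X_j * 'X_i) ^+ e * (G i * 'X_j ^+ m - G j * 'X_i ^+ m).
    apply: (@frac_inj k n); have Xi := @fracX_neq0 k n i m.
    have Xj := @fracX_neq0 k n j m.
    have W0 : frac (('X_j * 'X_i) ^+ e) != 0.
      by apply: frac_neq0; rewrite exprMn mulf_neq0 ?X_neq0.
    rewrite (exprMn_comm m) ?fracM; last exact: mulrC.
    rewrite [frac (_ - _)]tofracB !fracM.
    exact: (cross_multiply Xi Xj W0 (cG j i) cji).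
  have sji : sing (rep p) (G i * 'X_j ^+ m - G j * 'X_i ^+ m).
    apply: (@sing_cancel _ _ _ _ (('X_j * 'X_i) ^+ e)).
      rewrite at_rowE expf_neq0 // at_rowM mulf_neq0 //.
      by rewrite at_rowX rep_pivot oner_neq0.
    by rewrite -key; apply: singM; exact: double_points_sing JH pS.
  apply: (@sing_cancel _ _ _ _ ('X_j ^+ m)).
    by rewrite at_pivot oner_neq0.
  have -> : 'X_j ^+ m * (G i - F * 'X_i ^+ m) =
      (G i * 'X_j ^+ m - G j * 'X_i ^+ m) + 'X_i ^+ m * (G j - F * 'X_j ^+ m).
    move: (G i) (G j) ('X_i ^+ m) ('X_j ^+ m); clear => *; ring.
  by apply: singD => //; apply: singM.
exists (fun i => frac (G i) / frac ('X_i ^+ m) - frac F); split; last first.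
  by move=> i j; rewrite cG opprB addrA subrK.
move=> i; have [N hN] := saturation i (loc i).
apply/section1P; exists (N + (2 + m))%N.
exists ('X_i ^+ N * ('X_i ^+ 2 * (G i - F * 'X_i ^+ m))).
split=> //.
  have -> : (d.+1 + (N + (2 + m)) = N + (2 + (d.+1 + m)))%N by lia.
  apply: dhomogM; first exact: homogXn.
  by apply: dhomogM => //; exact: homogXn.
have X0 e := @fracX_neq0 k n i e.
rewrite !exprD !fracM [frac (_ - _)]tofracB !fracM.
exact: (common_denominator _ _ (X0 m) (X0 N)
  (mulf_neq0 (X0 1%N) (X0 1%N))).
Qed.


Lemma evaluate_neq0 (I : finType) (v : I -> 'rV[k]_n.+1) z (i : I)
    (j : 'I_n.+1) d :
  tangent v z -> v i 0 j = 1 -> z i != 0 ->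
  exists T, T \is d.+1.-homog /\ evaluate v z T i != 0.
Proof.
move=> tz vj; have X1 m : at_row ('X_j ^+ m) (v i) = 1.
  by rewrite at_rowE at_rowX vj expr1n.
have along0l F u : along 0 F u = 0.
  by rewrite /along big1 // => c _; rewrite mxE mul0r.
have [wi|/tz wi _] := eqVneq (z i).2 0.
  move=> nz; exists ('X_j ^+ d.+1); split; first exact: homogXn.
  rewrite /evaluate X1 wi along0l mulr1 addr0; apply: contraNneq nz => ai.
  by rewrite [z i]surjective_pairing ai wi.
have [l [vl lw]] := separate wi; exists (lform l * 'X_j ^+ d); split.
  exact: (dhomogM (homog_lform l) (homogXn _ j d)).
rewrite evaluate_lform /evaluate /residual /= (lval_sub vl (submx_refl _)).
by rewrite scale0r along0l X1 mulr0 add0r mulr1 addr0.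
Qed.

Lemma evaluate_sing (I : finType) (v : I -> 'rV[k]_n.+1) z (i : I) F :
  sing (v i) F -> evaluate v z F i = 0.
Proof.
by move=> sF; rewrite /evaluate (sing_along _ sF) (proj1 sF) mulr0 addr0.
Qed.

(** By [comaximal] the fractions e_i = E_i / X_i^N are congruent to 1 to first
    order at p and to 0 at the other points of A, over each standard open set.
    Hence T e_j - T e_i is a cocycle of the ideal sheaf of 2A.  If it bounds,
    correcting the T e_i gives a global form F with the jet of T at p and
    singular at the other points; but the relation z, which does not kill the
    jet of T at p, kills F. *)
Lemma relation_h1 (I : finType) (pt : I -> projspace k n) A d z :
  (1 <= n)%N -> injective pt ->
  tangent (fun s => rep (pt s)) z -> kills (fun s => rep (pt s)) d.+1 z ->
  (exists i : I, z i != 0) -> (forall i : I, pt i \notin A -> z i = 0) ->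
  ~ h1_eq0 (double_points A) d.+1.
Proof.
move=> n1 pt_inj tz kz [i0 nz] supp h1.
pose p := pt i0; have pA : p \in A.
  by apply: contraNT nz => /supp->.
have [T [hT Tz]] := evaluate_neq0 d tz (rep_pivot p) nz.
pose N := (3 * #|` (A `\ p)%fset|)%N.
have hE i : exists E, [/\ E \is N.-homog, double_points (A `\ p)%fset E &
                double_points [fset p]%fset ('X_i ^+ N - E)].
  by apply: comaximal; rewrite in_fsetD1 eqxx.
have {hE} [E hE] := fin_all_exists hE.
clearbody N.
pose num i j := T * (E j * 'X_i ^+ N - E i * 'X_j ^+ N).
have Eq i q : q \in A -> q != p -> double_points [fset q]%fset (E i).
  move=> qA qp; have [_ EA _] := hE i; apply: double_pointsS EA => r /fset1P->.
  by rewrite in_fsetD1 qp.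
have numA i j q : q \in A -> double_points [fset q]%fset (num i j).
  move=> qA; apply: double_pointsM; have [->|qp] := eqVneq q p.
    have [_ _ Ei] := hE i; have [_ _ Ej] := hE j.
    have -> : E j * 'X_i ^+ N - E i * 'X_j ^+ N =
        'X_j ^+ N * ('X_i ^+ N - E i) + (- 'X_i ^+ N) * ('X_j ^+ N - E j).
      move: (E i) (E j) ('X_i ^+ N) ('X_j ^+ N); clear => *; ring.
    by apply: ideal_squareD; apply: double_pointsM.
  by rewrite ![E _ * _]mulrC -mulNr; apply: ideal_squareD;
    apply: double_pointsM; exact: Eq.
pose e i := frac (T * E i) / frac ('X_i ^+ N).
pose c i j := e j - e i.
have [] := h1 c.
  split; last by move=> i j l; rewrite /c; move: (e i) (e j) (e l) => *; ring.
  move=> i j; have [<-|ij] := eqVneq i j.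
    exists 0%N, 0; split; [exact: ideal_square0|exact: dhomog0|].
    by rewrite /c subrr tofrac0 mul0r.
  have [a ha] := saturation i (numA i j).
  apply/section2P => //; exists (N + a)%N, ('X_j ^+ a * ('X_i ^+ a * num i j)).
  split; first exact: double_pointsM.
    have -> : (d.+1 + (N + a) * 2 = a + (a + (d.+1 + (N + N))))%N by lia.
    have [hEi _ _] := hE i; have [hEj _ _] := hE j.
    do 2 (apply: dhomogM; first exact: homogXn); apply: dhomogM => //.
    by rewrite rpredB // dhomogM // homogXn.
  have X0 j' m := @fracX_neq0 k n j' m.
  have -> : ('X_i * 'X_j) ^+ (N + a) =
      'X_i ^+ N * 'X_i ^+ a * ('X_j ^+ N * 'X_j ^+ a) :> poly.
    by rewrite exprMn !exprD.
  rewrite /c /e /num !fracM [frac (_ - _)]tofracB !fracM.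
  exact: (difference_fraction _ _ _ (X0 i N) (X0 j N) (X0 i a) (X0 j a)).
move=> b [sb cb].
have hB i : exists mB : nat * poly, [/\ double_points A mB.2,
     mB.2 \is (d.+1 + mB.1).-homog & b i = frac mB.2 / frac ('X_i ^+ mB.1)].
  by have [m [B hB]] := proj1 (section1P _ _ _ _) (sb i); exists (m, B).
have {hB} [mB hB] := fin_all_exists hB.
pose m i := (mB i).1; pose B i := (mB i).2.
pose f i := frac (T * E i * 'X_i ^+ (m i) - B i * 'X_i ^+ N) /
            frac ('X_i ^+ (N + m i)).
have fE i : f i = e i - b i.
  have [_ _ ->] := hB i; rewrite /f /e -/(m i) -/(B i) exprD.
  rewrite [frac (_ - _)]tofracB !fracM.
  by apply: subtract_fraction; exact: fracX_neq0.
have fij i j : f i = f j.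
  by rewrite !fE; apply: exchange_difference; exact: cb i j.
have hnum i : T * E i * 'X_i ^+ (m i) - B i * 'X_i ^+ N
              \is (d.+1 + (N + m i)).-homog.
  have [hEi _ _] := hE i; have [_ hBi _] := hB i.
  rewrite rpredB //.
    by rewrite addnA; apply: dhomogM (homogXn _ _ _); exact: dhomogM.
  have -> : (d.+1 + (N + m i) = d.+1 + m i + N)%N by lia.
  by apply: dhomogM (homogXn _ _ _).
(* The differences T e_i - b_i glue to a form F. *)
have i1 : (ord0 : 'I_n.+1) != inord 1 by rewrite -val_eqE /= inordK.
have [F [hF f0]] := cech_H0 i1 (hnum ord0) (fij ord0 (inord 1)).
have FE i : F * 'X_i ^+ (N + m i) = T * E i * 'X_i ^+ (m i) - B i * 'X_i ^+ N.
  apply: (@frac_inj k n); rewrite fracM -f0 -/(f ord0) (fij _ i) /f divfK //.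
  exact: fracX_neq0.
have other q : q \in A -> q != p -> sing (rep q) F.
  move=> qA qp; set i := pivot q.
  apply: (@sing_cancel _ _ _ _ ('X_i ^+ (N + m i))).
    by rewrite at_pivot oner_neq0.
  have [BA _ _] := hB i.
  rewrite mulrC FE; apply: singD.
    rewrite mulrAC; apply: singM.
    exact: double_points_sing (Eq _ _ qA qp) (fset11 q).
  rewrite -mulNr mulrC -mulN1r mulrCA; do 2 apply: singM.
  exact: double_points_sing BA qA.
have at_p : sing (rep p) (T - F).
  set i := pivot p; have [BA _ _] := hB i; have [_ _ Ep] := hE i.
  apply: (@sing_cancel _ _ _ _ ('X_i ^+ (N + m i))).
    by rewrite at_pivot oner_neq0.
  rewrite mulrBr [X in _ - X]mulrC FE.
  have -> : 'X_i ^+ (N + m i) * T - (T * E i * 'X_i ^+ m i - B i * 'X_i ^+ N) =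
     T * 'X_i ^+ m i * ('X_i ^+ N - E i) + 'X_i ^+ N * B i.
    rewrite exprD; move: (E i) (B i) ('X_i ^+ N) ('X_i ^+ m i).
    by clear => *; ring.
  apply: singD; apply: singM.
    exact: double_points_sing Ep (fset11 p).
  exact: double_points_sing BA pA.
move/kills_evaluate: kz => /(_ F hF).
rewrite (bigD1 i0) //= big1 ?addr0; last first.
  move=> i ii0; have [iA|/supp zi] := boolP (pt i \in A); last first.
    rewrite /evaluate zi /= mul0r add0r /along big1 // => c' _.
    by rewrite mxE mul0r.
  apply: evaluate_sing; apply: other => //.
  by apply: contra ii0 => /eqP/pt_inj->.
have := @evaluate_sing I (fun s => rep (pt s)) z i0 _ at_p.
rewrite -scaleN1r addrC evaluate_linear mulN1r addrC => /eqP.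
by rewrite subr_eq0 => /eqP <- /eqP; rewrite (negbTE Tz).
Qed.

End Bridges.

(** * Spanning sets and minimality *)

Section Spanning.

Variables (k : fieldType) (n : nat) (S : {fset projspace k n}).

Definition point (p : S) : 'rV[k]_n.+1 := rep (val p).

Lemma point_inj (p q : S) : (point p <= point q)%MS -> p = q.
Proof. by move/rep_inj/val_inj. Qed.

(** Otherwise a nonzero linear form vanishing on the row space of B would vanish
    on all of S. *)
Lemma spanning_not_sub m (B : 'M[k]_(m, n.+1)) : spanning S -> (m <= n)%N ->
  exists p, ~~ (point p <= B)%MS.
Proof.
move=> span mn; apply/existsP; apply: contraT => /existsPn h.
have [u uB] : exists u : 'rV[k]_n.+1, ~~ (u <= B)%MS.
  have : ~~ (1%:M <= B)%MS.
    apply/negP => /mxrankS; rewrite mxrank1 => le.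
    by have := leq_trans le (rank_leq_row B); lia.
  by case/row_subPn => j hj; exists (row j 1%:M).
have [l [Bl lu]] := separate uB.
pose f := linfun (mulmxr l : 'rV[k]_n.+1 -> 'M[k]_1).
have : (fullv <= lker f)%VS.
  rewrite -span big_seq; elim/big_ind: _ => [|U V hU hV|p pS].
  - exact: sub0v.
  - by rewrite subv_add hU.
  rewrite [val p]rep_line -memvE memv_ker lfunE /=.
  have /(_ [` pS]%fset) := h; rewrite negbK /point /= => pB.
  rewrite [_ *m _]mx11_scalar -[_ 0 0]/(lval l (rep p)).
  by rewrite (lval_sub Bl pB) raddf0.
move/subvP/(_ u (memvf _)); rewrite memv_ker lfunE /= => /eqP ul.
by move: lu; rewrite /lval ul mxE eqxx.
Qed.

End Spanning.

(** The relation behind a minimal S involves all of S, since a relation on a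
    proper subset contradicts minimality by [relation_h1]; the same
    contradiction bounds the number of points on a line. *)
Lemma no_min_Terracini (k : fieldType) d x (S : {fset projspace k 3}) :
  (1 < d)%N -> (2 * x <= 3 * d + 1)%N -> ~ min_Terracini d x S.
Proof.
case: d => // d d_gt1 le_x [[cardS _ [c [cc ncob]] span] minS].
pose v := @point k 3 S.
have val_injS : injective (val : S -> projspace k 3) by exact: val_inj.
have v0 p : v p != 0 by exact: rep_neq0.
have vI p q : (v p <= v q)%MS -> p = q by exact: point_inj.
have proper_kills (A : {fset projspace k 3}) z : (A `<` S)%fset ->
    tangent v z -> kills v d.+1 z -> (exists i, z i != 0) ->
    (forall i, val i \notin A -> z i = 0) -> False.
  move=> AS tz kz nz supp.
  exact: (@relation_h1 _ _ _ _ A d z isT val_injS tz kz nz supp (minS A AS)).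
suff none z : tangent v z -> kills v d.+1 z -> forall i, z i = 0.
  apply/ncob/jets_h1_eq0 => // T.
  exact: (jets_onto (fun p => rep_pivot (val p)) none T).
move=> tz kz i; apply/eqP; apply: contraT => nzi.
have all_nz j : z j != 0.
  apply/negP => /eqP zj; apply: (proper_kills (S `\ val j)%fset z) => //.
  - exact/fproperD1/valP.
  - by exists i.
  move=> i'; rewrite in_fsetD1 negb_and negbK (valP i') orbF => /eqP/val_inj->.
  exact: zj.
exfalso; apply: (no_spanning_relation v0 vI _ kz tz _ all_nz).
- lia.
- apply: leq_trans (_ : \sum_(j : S) 2 <= _)%N.
    by apply: leq_sum => j _; exact: wt_le2.
  by rewrite sum_nat_const -cardfE cardS; lia.
- by move=> B; exact: spanning_not_sub.
move=> B; rewrite leqNgt; apply/negP => big.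
pose A := [set j | (v j <= B)%MS].
have cA : #|A| = #|[pred j | (v j <= B)%MS]|.
  by apply: eq_card => j; rewrite !inE.
have [|||z' [tz' kz' nz' supp]] := @line_relation _ _ _ v v0 vI d.+1 B A.
- by move=> j; rewrite inE.
- by rewrite -cA in big; lia.
- by rewrite -cA in big.
apply: (proper_kills [fset val j | j in A]%fset z') => //.
  rewrite fproperEneq; apply/andP; split.
    have [p pB] := spanning_not_sub B span isT.
    apply: contraNneq pB => AS.
    have : val p \in [fset val j | j in A]%fset by rewrite AS (valP p).
    by case/imfsetP => q /=; rewrite inE => qB /val_inj->.
  by apply/fsubsetP => q /imfsetP[j _ ->]; exact: valP.
move=> j jA; apply: supp; apply: contra jA => jA.
by apply/imfsetP; exists j.
Qed.

Local Close Scope ring_scope.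

Theorem theorem1p3 (k : closedFieldType) (char0 : [pchar k]%R =i pred0)
    (d x : nat) (d_ge4 : 4 <= d) (le_x : 2 * x <= 3 * d + 1)
    (S : {fset projspace k 3}) :
  ~ min_Terracini d x S.
Proof. by apply: no_min_Terracini le_x; apply: leq_trans d_ge4. Qed.
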